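(* Let $n,k,j$ be integers with $0\leq j\leq n-k-1\leq n-1$. There exists a constant $\alpha_{n,k,j}>0$, depending only on $n,k$ and $j$, such that for every centrally symmetric convex body $K$ in $\mathbb{R}^n$, $$W_j(K)^{n-k-j}\leq \alpha_{n,k,j}\max_{F\in G_{n,n-k}}W_j(K\cap F)^{n-j}.$$
   Context: A convex body in $\mathbb{R}^n$ is a compact convex set with non-empty interior; it is centrally symmetric if $x\in K$ implies $-x\in K$. $|\cdot|$ denotes volume in the appropriate dimension. $G_{n,m}$ is the Grassmann manifold of $m$-dimensional linear subspaces of $\mathbb{R}^n$. For a convex body $L$ in an $m$-dimensional Euclidean space, the quermassintegrals $W_0(L),\ldots,W_m(L)$ are defined by Steiner's formula $|L+\lambda B|=\sum_{i=0}^m\binom{m}{i}W_i(L)\lambda^i$ for $\lambda\geq 0$, where $B$ is the Euclidean unit ball of that space; equivalently $W_i(L)$ is the mixed volume of $m-i$ copies of $L$ and $i$ copies of $B$. Here $W_j(K)$ is taken in dimension $n$, and for $F\in G_{n,n-k}$ the quantity $W_j(K\cap F)$ is taken in the $(n-k)$-dimensional space $F$. *)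

(* Defs.v *)
From mathcomp Require Export all_boot all_order all_algebra.
From mathcomp Require Export all_classical all_reals all_analysis.
Set Implicit Arguments.
Unset Strict Implicit.
Unset Printing Implicit Defensive.
Import Order.TTheory GRing.Theory Num.Theory.
Import numFieldNormedType.Exports.
Local Open Scope classical_set_scope.
Local Open Scope ring_scope.

(* m-dimensional Lebesgue measure on 'rV[R]_m, as the m-fold product of the
   one-dimensional one: the successor case is literally the integral of the
   measures of the sections, as in the library's [product_measure1].  It is the
   Lebesgue measure on Borel sets; only compact sets are measured below. *)
Fixpoint vol (R : realType) (m : nat) : set 'rV[R]_m -> \bar R :=
  match m return set 'rV[R]_m -> \bar R with
  | 0 => fun A => (\1_A (0 : 'rV[R]_0))%:E
  | m'.+1 => fun A =>
      (\int[@lebesgue_measure R]_t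
         vol [set x : 'rV[R]_m' | A (row_mx (t%:M : 'rV[R]_1) x)])%E
  end.

(* The library norm on 'rV[R]_m is the sup norm, hence the explicit formula. *)
Definition eball (R : realType) (m : nat) : set 'rV[R]_m :=
  [set x | \sum_(i < m) x 0 i ^+ 2 <= 1].

Definition parallel_body (R : realType) (m : nat) (L : set 'rV[R]_m)
    (lambda : R) : set 'rV[R]_m :=
  [set x + lambda *: b | x in L & b in @eball R m].

(* Only the values W 0, ..., W m are constrained, and they are unique. *)
Definition steiner (R : realType) (m : nat) (L : set 'rV[R]_m)
    (W : nat -> R) : Prop :=
  forall lambda : R, 0 <= lambda ->
    vol (parallel_body L lambda) =
    (\sum_(i < m.+1) 'C(m, i)%:R * W i * lambda ^+ i)%:E.

(* W_j(L) for j <= m; the default 0 would only be taken if L had no Steiner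
   polynomial, which does not happen for a compact convex L. *)
Definition quermass (R : realType) (m : nat) (j : nat)
    (L : set 'rV[R]_m) : R :=
  xget 0 [set w | exists2 W : nat -> R, steiner L W & w = W j].

Definition convex_body (R : realType) (n : nat) (K : set 'rV[R]_n) : Prop :=
  [/\ compact K, @convex_set R 'rV[R]_n K & K^° !=set0].

Definition centrally_symmetric (R : realType) (n : nat)
    (K : set 'rV[R]_n) : Prop :=
  forall x, K x -> K (- x).

Definition grassmann (R : realType) (n m : nat) : set {vspace 'rV[R]_n} :=
  [set F | \dim F = m].
Arguments grassmann : clear implicits.

Definition orthonormal_frame (R : realType) (n : nat)
    (F : {vspace 'rV[R]_n}) (U : 'M[R]_(\dim F, n)) : Prop :=
  U *m U^T = 1%:M /\ forall i, row i U \in F.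

Definition frame (R : realType) (n : nat) (F : {vspace 'rV[R]_n}) :
    'M[R]_(\dim F, n) :=
  xget 0 [set U | orthonormal_frame U].

(* The Euclidean space F is identified with R^(\dim F) through orthonormal
   coordinates y |-> y *m frame F; volume, unit ball and hence quermassintegrals
   do not depend on the chosen frame. *)
Definition in_coords (R : realType) (n : nat) (F : {vspace 'rV[R]_n})
    (A : set 'rV[R]_n) : set 'rV[R]_(\dim F) :=
  [set y | A (y *m frame F)].
Arguments in_coords {R n} F A _.

Definition quermass_in (R : realType) (n : nat) (F : {vspace 'rV[R]_n})
    (j : nat) (A : set 'rV[R]_n) : R :=
  quermass j (in_coords F A).

Definition is_max (R : realType) (S : set R) (M : R) : Prop :=
  S M /\ ubound S M.

(* Main.v *)
(** The Steiner polynomial exists because the ball is a limit of zonotopes: by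
    Cavalieri, adding a segment of half-length proportional to lambda to a
    convex set adds to its volume lambda times a multiple of the volume of a
    projection, so that the volume of K + lambda Z is, for a zonotope Z, a
    polynomial in lambda with coefficients that are nonnegative and monotone
    in K; these properties pass to the limit.

    Choose greedily an orthonormal frame u_0, u_1, ... such that a_i u_i is a
    longest vector of K orthogonal to u_0, ..., u_(i-1). Then a_0 >= a_1 >= ...,
    and K contains every a_i u_i and lies in the box with half-sides 2^n a_i in
    the frame. Comparing with boxes gives W_j(K) <= C a_0 ... a_(n-j-1), while the
    section by the span of u_0, ..., u_(n-k-1) has its j-th quermassintegral at
    least c a_0 ... a_(n-k-j-1). As the a_i decrease,
    (a_0 ... a_(n-j-1))^(n-k-j) <= (a_0 ... a_(n-k-j-1))^(n-j). *)
From HB Require Import structures.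
Require Import Defs.
From mathcomp Require Import perm measurable_realfun ring lra.
Import Order.TTheory GRing.Theory Num.Theory.
Import numFieldNormedType.Exports.
Local Open Scope classical_set_scope.
Local Open Scope ring_scope.
Set Implicit Arguments.
Unset Strict Implicit.
Unset Printing Implicit Defensive.

(** * Lebesgue measure of row vectors *)

(** [vol] is an iterated integral in fixed coordinates, so its invariance under rotations has to be
    proved. It is needed twice: it frees [quermass_in] from the choice of the frame, and it is what
    makes averages of segments converge to a ball. The zonotopes spare any theory of mixed volumes:
    their coefficients are sums of products of nonnegative factors with volumes of projections,
    hence visibly nonnegative and monotone. Given these two properties, the upper bound needs one
    value of the Steiner polynomial only. A single term is at most the whole sum, and at lambda =
    a_(n-j-1) the last j sides of the enlarged box are comparable with lambda, so that they supply
    the factor lambda^j to be cancelled. No single value gives the lower bound, since all the terms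
    contribute to it. It is read off as lambda tends to 0, from a box in which j sides are collapsed
    to 0 so that its polynomial starts at lambda^j. *)

Definition borel (R : realType) (m : nat) := g_sigma_algebraType (@open 'rV[R]_m).

(** It takes a pair in order to be a map on the product space, and its body is the term in the
    successor case of [vol], so that sections can be folded into it. *)
Definition cons_row (R : realType) (m : nat) (p : R * 'rV[R]_m) : 'rV[R]_m.+1 :=
  row_mx (p.1%:M : 'rV[R]_1) p.2.

Section Borel.
Variable R : realType.

Lemma open_borel m (U : set 'rV[R]_m) : open U -> measurable (U : set (borel R m)).
Proof. by move=> oU; apply: sub_sigma_algebra. Qed.

Lemma closed_borel m (U : set 'rV[R]_m) : closed U -> measurable (U : set (borel R m)).
Proof.
move=> cU; rewrite -[U]setCK; apply: measurableC.
by apply: open_borel; rewrite openC.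
Qed.

Lemma continuous_borel m n (f : 'rV[R]_m -> 'rV[R]_n) : continuous f ->
  measurable_fun setT (f : borel R m -> borel R n).
Proof.
move=> cf; apply: (@measurability _ _ (borel R m) (borel R n) setT f (@open 'rV[R]_n)) => //.
move=> _ [U oU <-]; rewrite setTI; apply: open_borel.
by move/continuousP: cf; apply.
Qed.

Lemma rV_continuous (T : topologicalType) n (f : T -> 'rV[R]_n) :
  (forall i, continuous (fun x => f x 0 i)) -> continuous f.
Proof.
move=> cf x; apply/cvg_ballP => e e0.
have : \forall y \near x, forall i, ball (f x 0 i) e (f y 0 i).
  apply: filter_forall => i; move: (cf i x) => /cvg_ballP; exact.
apply: filterS => y H; split => // i j; rewrite ord1; exact: H.
Qed.

Lemma coord_le_norm m (x : 'rV[R]_m) i : `|x 0 i| <= `|x|.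
Proof.
rewrite [leRHS]/Num.norm /= mx_normrE; apply/bigmax_geP; right => /=.
by exists (0, i).
Qed.

Lemma cons_row0 m (p : R * 'rV[R]_m) : cons_row p 0 0 = p.1.
Proof.
rewrite /cons_row (_ : 0 = lshift m (0 : 'I_1)); last exact: val_inj.
by apply: etrans (@row_mxEl R 1 1 m p.1%:M p.2 0 0) _; rewrite mxE.
Qed.

Lemma cons_rowS m (p : R * 'rV[R]_m) i : cons_row p 0 (lift 0 i) = p.2 0 i.
Proof.
rewrite /cons_row (_ : lift 0 i = rshift 1 i); last exact: val_inj.
exact: (@row_mxEr R 1 1 m p.1%:M p.2 0 i).
Qed.

(** An open set is a countable union of measurable rectangles: take the balls I with rational centre
    and radius 1/(k+1), and for each the interior V of the set of those y with I x {y} inside U.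
    Only the first factor needs a countable base. *)
Lemma measurable_cons_row m :
  measurable_fun setT (@cons_row R m : measurableTypeR R * borel R m -> borel R m.+1).
Proof.
apply: (@measurability _ _ (measurableTypeR R * borel R m)%type (borel R m.+1) setT (@cons_row R m) (@open 'rV[R]_m.+1)) => //.
move=> _ [U oU <-]; rewrite setTI.
pose I (qk : rat * nat) := ball (ratr qk.1 : R) (qk.2.+1%:R^-1).
pose V (qk : rat * nat) : set 'rV[R]_m :=
  interior [set y | forall t, I qk t -> U (cons_row (t, y))].
have -> : cons_row (m:=m) @^-1` U = \bigcup_(qk in setT) (I qk `*` V qk).
  apply/seteqP; split => [[t y] /= Uty|[t y] [qk _] /= [It /interior_subset]]; last first.
    exact.
  have /nbhs_ballP [e /= e0 Ue] : nbhs (cons_row (t, y)) U by exact: open_nbhs_nbhs.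
  have [k k2] : exists k : nat, (k.+1%:R^-1 : R) < e / 2.
    exists (Num.truncn (e / 2)^-1).
    rewrite invf_plt ?posrE ?divr_gt0 ?ltr0n//.
    by rewrite truncnS_gt.
  have k0 : 0 < (k.+1%:R^-1 : R) by rewrite invr_gt0 ltr0n.
  have [q qt] : exists q : rat, ball t k.+1%:R^-1 (ratr q : R).
    have : t - k.+1%:R^-1 < t + k.+1%:R^-1 by rewrite ltrBlDr -addrA ltrDl addr_gt0.
    move/rat_in_itvoo => [q]; rewrite in_itv/= => /andP[q1 q2]; exists q.
    by rewrite /ball/= ltr_distlC q1 q2.
  exists (q, k) => //; split; first exact: ball_sym.
  apply/nbhs_ballP; exists e => //= y' yy' t' It'.
  apply: Ue; split => // i j; rewrite (ord1 i).
  case: (unliftP 0 j) => [j' ->|->]; rewrite ?cons_row0 ?cons_rowS/=.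
    by case: yy' => _; apply.
  rewrite (splitr e); apply: (@ball_triangle _ _ (ratr q : R)).
    by apply: le_ball qt; exact: ltW.
  by apply: le_ball It'; exact: ltW.
apply: countable_bigcupT_measurable => // -[q k].
apply: measurableX; first exact: measurable_ball.
by apply: open_borel; exact: open_interior.
Qed.

Lemma integral_indic_segment (a b : R) : a <= b ->
  (\int[@lebesgue_measure R]_t (\1_(`[a, b]%classic) t)%:E = (b - a)%:E)%E.
Proof.
move=> ab; rewrite integral_indic// setIT.
apply: etrans (lebesgue_measure_itv _) _; rewrite /= lte_fin.
by case: ltgtP ab => // -> _; rewrite subrr.
Qed.

Lemma vol_box m (l u : 'I_m -> R) : (forall i, l i <= u i) ->
  vol [set x : 'rV[R]_m | forall i, l i <= x 0 i <= u i] = (\prod_i (u i - l i))%:E.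
Proof.
elim: m l u => [|m IH] l u lu /=.
  by rewrite big_ord0 indicE mem_set//= => -[].
transitivity (\int[@lebesgue_measure R]_t
  ((\prod_i (u (lift 0 i) - l (lift 0 i)))%:E * (\1_(`[l 0, u 0]%classic) t)%:E))%E.
  apply: eq_integral => t _; rewrite indicE.
  have [tlu|tlu] := boolP (t \in `[l 0, u 0]%classic).
    rewrite mule1 -IH//; congr vol; apply/seteqP; split => x /= H i.
      by have := H (lift 0 i); rewrite (cons_rowS (t, x)).
    case: (unliftP 0 i) => [i' ->|->].
      by rewrite (cons_rowS (t, x)).
    rewrite (cons_row0 (t, x)).
    by move: tlu; rewrite inE /= in_itv.
  rewrite mule0 (_ : [set _ | _] = set0).
    by clear; elim: m => [|m IHm] /=; [rewrite indic0|rewrite integral0_eq].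
  apply/seteqP; split => x //= /(_ 0); rewrite (cons_row0 (t, x)) /= => H.
  by move: tlu; rewrite notin_setE /= in_itv /= H.
rewrite integralZl//; last first.
  apply/integrableP; split; first by apply/measurable_EFinP.
  under eq_integral do rewrite gee0_abs//.
  by rewrite integral_indic_segment ?ltry.
by rewrite integral_indic_segment// big_ord_recl muleC -EFinM.
Qed.

Definition vol_measure m : set (borel R m) -> \bar R := @vol R m.

(** The product measure in dimension m.+1 requires a sigma-finite measure in dimension m, so the
    whole structure is carried through the induction; the canonical instances are declared
    afterwards. *)
Lemma vol_exists_measure m : exists mu : {sigma_finite_measure set (borel R m) -> \bar R},
  forall A, mu A = vol A.
Proof.
elim: m => [|m [mu muE]].
  by exists (@dirac _ (borel R 0) 0 R) => A /=.
pose p := pushforward (@lebesgue_measure R \x mu)%E (@cons_row R m : measurableTypeR R * borel R m -> borel R m.+1).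
have volE A : p A = vol A.
  rewrite /p /pushforward /product_measure1 /=; apply: eq_integral => t _ /=.
  rewrite muE; congr vol; apply/seteqP; split => x /=; rewrite /xsection /= ?inE//.
pose p' : {measure set (borel R m.+1) -> \bar R} :=
  measure_function_pushforward__canonical__measure_function_Measure
    (@lebesgue_measure R \x mu)%E (@measurable_cons_row m).
have sf : sigma_finite [set: borel R m.+1] p'.
  exists (fun k : nat => [set x : 'rV[R]_m.+1 | forall i, - k%:R <= x 0 i <= k%:R]).
    apply/seteqP; split => x //= _.
    exists (Num.truncn (`|x|)).+1 => //= i.
    rewrite -ler_norml; apply: (@le_trans _ _ `|x|); last by rewrite ltW// truncnS_gt.
    exact: coord_le_norm.
  move=> k; split.
    apply: closed_borel.
    rewrite (_ : [set _ | _] = \bigcap_i [set x : 'rV[R]_m.+1 | x 0 i \in `[- k%:R, k%:R]%R]).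
      apply: closed_bigI => i _.
      rewrite (_ : [set _ | _] = (fun x : 'rV[R]_m.+1 => x 0 i) @^-1` `[- k%:R, k%:R]%classic)//.
      apply: preimage_closed => [x _|]; last exact: itv_closed.
      exact: coord_continuous.
    apply/seteqP; split=> x /= H i; first by move=> _; rewrite /= in_itv /=.
    by have := H i I; rewrite /= in_itv.
  change (p [set x | forall i, - k%:R <= x 0 i <= k%:R]%R < +oo)%E.
  rewrite volE vol_box ?ltry//.
  by move=> i; rewrite (@le_trans _ _ 0) ?oppr_le0 ?ler0n.
have qE : @vol_measure m.+1 = p' by apply/funext => A; rewrite /vol_measure -volE.
have q0 : @vol_measure m.+1 set0 = 0%E by rewrite qE measure0.
have q1 A : (0 <= @vol_measure m.+1 A)%E by rewrite qE measure_ge0.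
have q2 : semi_sigma_additive (@vol_measure m.+1).
  by rewrite qE; exact: measure_semi_sigma_additive.
pose mm := isMeasure.Build _ (borel R m.+1) R (@vol_measure m.+1) q0 q1 q2.
pose pm : {measure set (borel R m.+1) -> \bar R} := HB.pack (@vol_measure m.+1) mm.
have sf' : sigma_finite setT pm by rewrite [X in sigma_finite _ X]qE.
pose sfm := Measure_isSigmaFinite.Build _ (borel R m.+1) R pm sf'.
pose p'' : {sigma_finite_measure set (borel R m.+1) -> \bar R} := HB.pack (@vol_measure m.+1) mm sfm.
by exists p''.
Qed.

Let vol0 m : @vol_measure m set0 = 0%E.
Proof. by have [mu muE] := vol_exists_measure m; rewrite /vol_measure -(muE set0) measure0. Qed.

Let vol_ge0' m (A : set (borel R m)) : (0 <= @vol_measure m A)%E.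
Proof. by have [mu muE] := vol_exists_measure m; rewrite /vol_measure -(muE A) measure_ge0. Qed.

Let vol_sigma m : semi_sigma_additive (@vol_measure m : set (borel R m) -> \bar R).
Proof.
have [mu muE] := vol_exists_measure m.
have -> : (@vol_measure m : set (borel R m) -> \bar R) = mu by apply/funext => A; rewrite muE.
exact: measure_semi_sigma_additive.
Qed.

HB.instance Definition _ m := isMeasure.Build _ (borel R m) R (@vol_measure m)
  (@vol0 m) (@vol_ge0' m) (@vol_sigma m).

Let vol_sf m : sigma_finite [set: borel R m] (@vol_measure m).
Proof.
have [mu muE] := vol_exists_measure m.
have -> : (@vol_measure m : set (borel R m) -> \bar R) = mu by apply/funext => A; rewrite muE.
exact: sigma_finiteT.
Qed.

HB.instance Definition _ m := Measure_isSigmaFinite.Build _ (borel R m) R (@vol_measure m)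
  (@vol_sf m).

Lemma vol_prod m (A : set (borel R m.+1)) :
  vol A = (@lebesgue_measure R \x @vol_measure m)%E (@cons_row R m @^-1` A).
Proof.
rewrite /product_measure1 /=; apply: eq_integral => t _ /=.
by congr vol; apply/seteqP; split => x /=; rewrite /xsection /= ?inE// => Ax; rewrite inE.
Qed.

Lemma measurable_section m (A : set (borel R m.+1)) t : measurable A ->
  measurable [set x : borel R m | A (cons_row (t, x))].
Proof.
move=> mA; have := measurable_xsection t (measurable_cons_row measurableT mA).
congr measurable; rewrite setTI; apply/seteqP.
by split => x /=; rewrite /xsection /= ?inE// => Ax; rewrite inE.
Qed.

Lemma measurable_fun_section m (A : set (borel R m.+1)) : measurable A ->
  measurable_fun setT (fun t : measurableTypeR R =>
    vol [set x : 'rV[R]_m | A (cons_row (t, x))]).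
Proof.
move=> mA; have := measurable_fun_xsection (@vol_measure m) (measurable_cons_row measurableT mA).
congr measurable_fun; apply/funext => t /=; congr vol; rewrite setTI; apply/seteqP.
by split => x /=; rewrite /xsection /= ?inE// => Ax; rewrite inE.
Qed.

Lemma vol_le m (A B : set 'rV[R]_m) : measurable (A : set (borel R m)) ->
  measurable (B : set (borel R m)) -> A `<=` B -> (vol A <= vol B)%E.
Proof. by move=> mA mB AB; apply: (@le_measure _ _ _ (@vol_measure m)); rewrite ?inE. Qed.

(** The pushforward of Lebesgue measure by the translation is correct on half-open intervals, and
    these determine the measure. *)
Lemma lebesgue_translation (f : R -> \bar R) c :
  measurable_fun setT (f : measurableTypeR R -> _) -> (forall t, 0 <= f t)%E ->
  (\int[@lebesgue_measure R]_t f (t + c)%R = \int[@lebesgue_measure R]_t f t)%E.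
Proof.
move=> mf f0.
have mc : measurable_fun setT ((fun t => t + c) : measurableTypeR R -> measurableTypeR R).
  exact: measurable_funD.
pose mu : {measure set (measurableTypeR R) -> \bar R} :=
   measure_function_pushforward__canonical__measure_function_Measure (@lebesgue_measure R) mc.
transitivity (\int[mu]_t f t)%E.
  by rewrite ge0_integral_pushforward.
apply: eq_measure_integral => A mA _; apply/esym; apply: lebesgue_measure_unique => //.
move=> _ [[a b] _ <-]; rewrite /mu /= /pushforward.
rewrite (_ : _ @^-1` _ = `]a - c, b - c]%classic); last first.
  by apply/seteqP; split => t /=; rewrite !in_itv /= ltrBlDr lerBrDr.
by rewrite !lebesgue_measure_itv /= !lte_fin ltrD2r -!EFinB opprB addrA subrK.
Qed.

Lemma lebesgue_scaling (f : R -> \bar R) c : c != 0 ->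
  measurable_fun setT (f : measurableTypeR R -> _) -> (forall t, 0 <= f t)%E ->
  (\int[@lebesgue_measure R]_t f t = `|c|%:E * \int[@lebesgue_measure R]_t f (c * t)%R)%E.
Proof.
move=> c0 mf f0.
have mc : measurable_fun setT ((fun t => c * t) : measurableTypeR R -> measurableTypeR R).
  exact: measurable_funM.
pose mu : {measure set (measurableTypeR R) -> \bar R} :=
   measure_function_pushforward__canonical__measure_function_Measure (@lebesgue_measure R) mc.
have c0' : 0 <= `|c| by [].
transitivity (`|c|%:E * \int[mu]_t f t)%E; last first.
  by rewrite ge0_integral_pushforward.
pose nu : {measure set (measurableTypeR R) -> \bar R} := mscale (NngNum c0') mu.
transitivity (\int[nu]_t f t)%E; last first.
  by rewrite ge0_integral_mscale.
apply: eq_measure_integral => A mA _; apply: lebesgue_measure_unique => //.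
move=> _ [[a b] _ <-]; rewrite /nu /mu /= /mscale /= /pushforward.
(* For negative c the preimage of ]a, b] is closed on the left and open on the right, but has the
   same length as in the positive case. *)
move: c0; rewrite neq_lt => /orP[c0|c0].
  rewrite (_ : _ @^-1` _ = `[b / c, a / c[%classic); last first.
    by apply/seteqP; split => t /=; rewrite !in_itv /= ler_ndivrMr// ltr_ndivlMr// ![_ * c]mulrC andbC.
  rewrite !lebesgue_measure_itv /= !lte_fin ltr_ndivrMr// mulfVK ?lt_eqF//.
  case: ifP; rewrite ?mule0// -!EFinB -EFinM => _; congr EFin.
  by rewrite ltr0_norm//; field; rewrite lt_eqF.
rewrite (_ : _ @^-1` _ = `]a / c, b / c]%classic); last first.
  by apply/seteqP; split => t /=; rewrite !in_itv /= ltr_pdivrMr// ler_pdivlMr// ![_ * c]mulrC.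
rewrite !lebesgue_measure_itv /= !lte_fin ltr_pdivrMr// mulfVK ?gt_eqF//.
case: ifP; rewrite ?mule0// -!EFinB -EFinM => _; congr EFin.
by rewrite gtr0_norm//; field; rewrite gt_eqF.
Qed.

End Borel.

(** * Linear changes of variables *)

Section LinearInvariance.
Variable R : realType.

Lemma cons_row_surj m (x : 'rV[R]_m.+1) : exists p, x = cons_row p.
Proof.
exists (x 0 0, \row_i x 0 (lift 0 i)); apply/rowP => i.
by case: (unliftP 0 i) => [j ->|->]; rewrite ?cons_rowS ?cons_row0 //= mxE.
Qed.

Lemma cons_rowD m (p q : R * 'rV[R]_m) : cons_row p + cons_row q = cons_row (p + q).
Proof.
apply/rowP => i; rewrite mxE.
by case: (unliftP 0 i) => [j ->|->]; rewrite ?cons_rowS ?cons_row0 //= mxE.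
Qed.

Lemma cons_row_inj m (p q : R * 'rV[R]_m) : cons_row p = cons_row q -> p = q.
Proof.
move=> pq; case: p q pq => [a x] [b y] pq; congr pair.
  by have := congr1 (fun z : 'rV_m.+1 => z 0 0) pq; rewrite !cons_row0.
apply/rowP => i.
by have := congr1 (fun z : 'rV_m.+1 => z 0 (lift 0 i)) pq; rewrite !cons_rowS.
Qed.

Lemma sum_continuous (T : topologicalType) I (s : seq I) (f : I -> T -> R) :
  (forall i, continuous (f i)) -> continuous (fun x => \sum_(i <- s) f i x).
Proof.
move=> cf; elim: s => [|i s IH].
  by under eq_fun do rewrite big_nil; exact: cst_continuous.
under eq_fun do rewrite big_cons.
by move=> x; apply: cvgD; [exact: cf|exact: IH].
Qed.

Lemma mulmx_continuous m n (g : 'M[R]_(m, n)) : continuous (fun x : 'rV[R]_m => x *m g).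
Proof.
apply: rV_continuous => i; under eq_fun do rewrite mxE.
have ck k : continuous (fun x : 'rV[R]_m => x 0 k) by exact: coord_continuous.
apply: sum_continuous => k x.
by apply: (@continuousM _ _ (fun x : 'rV[R]_m => x 0 k) (fun=> g k i)); [exact: ck|exact: cst_continuous].
Qed.

Lemma translate_continuous m (v : 'rV[R]_m) : continuous (fun x : 'rV[R]_m => x + v).
Proof.
apply: rV_continuous => i; under eq_fun do rewrite mxE.
have ci : continuous (fun x : 'rV[R]_m => x 0 i) by exact: coord_continuous.
move=> x.
by apply: (@continuousD _ _ _ (fun x : 'rV[R]_m => x 0 i) (fun=> v 0 i)); [exact: ci|exact: cst_continuous].
Qed.

Lemma borel_preimage m n (f : 'rV[R]_m -> 'rV[R]_n) (A : set 'rV[R]_n) :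
  continuous f -> measurable (A : set (borel R n)) ->
  measurable ([set x | A (f x)] : set (borel R m)).
Proof.
move=> cf mA; have := continuous_borel cf measurableT mA.
by rewrite setTI.
Qed.

Lemma borel_mulmx m n (g : 'M[R]_(m, n)) (A : set 'rV[R]_n) :
  measurable (A : set (borel R n)) ->
  measurable ([set x | A (x *m g)] : set (borel R m)).
Proof. by apply: borel_preimage; exact: mulmx_continuous. Qed.

Lemma borel_translate m (v : 'rV[R]_m) (A : set 'rV[R]_m) :
  measurable (A : set (borel R m)) ->
  measurable ([set x | A (x + v)] : set (borel R m)).
Proof. by apply: borel_preimage; exact: translate_continuous. Qed.

Lemma vol_translate m (A : set 'rV[R]_m) v : measurable (A : set (borel R m)) ->
  vol [set x | A (x + v)] = vol A.
Proof.
elim: m A v => [|m IH] A v mA.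
  by congr vol; apply/seteqP; split => x /=; rewrite (thinmx0 (x + v)) (thinmx0 x).
have [[s w] ->] := cons_row_surj v.
transitivity (\int[@lebesgue_measure R]_t vol [set x | A (cons_row ((t + s)%R, x))])%E.
  apply: eq_integral => t _.
  rewrite -(IH [set x | A (cons_row ((t + s)%R, x))] w); last exact: measurable_section.
  by congr vol; apply/seteqP; split => x /=; rewrite -/(cons_row (t, x)) cons_rowD.
rewrite (lebesgue_translation (f := fun t => vol [set x | A (cons_row (t, x))]))//.
- exact: measurable_fun_section.
- by move=> t; exact: (measure_ge0 (@vol_measure R m)).
Qed.

(** The constant c is |det g|. It is left unnamed: where its value matters, for orthogonal maps and
    dilations, it is found by testing on one set. *)
Definition scales_vol m (g : 'M[R]_m) := exists2 c : R, 0 < c &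
  forall A : set 'rV[R]_m, measurable (A : set (borel R m)) ->
  vol A = (c%:E * vol [set x | A (x *m g)])%E.

Lemma scales_vol_mul m (g h : 'M[R]_m) : scales_vol g -> scales_vol h -> scales_vol (g *m h).
Proof.
move=> [c c0 gE] [d d0 hE]; exists (d * c); first exact: mulr_gt0.
move=> A mA; rewrite hE// (gE [set x | A (x *m h)]); last exact: borel_mulmx.
rewrite muleA EFinM; congr (_ * vol _)%E.
by apply/seteqP; split => x /=; rewrite mulmxA.
Qed.

Lemma scales_vol_inv m (g : 'M[R]_m) : g \in unitmx -> scales_vol g -> scales_vol (invmx g).
Proof.
move=> ug [c c0 gE]; exists c^-1; first by rewrite invr_gt0.
move=> A mA; rewrite (gE [set x | A (x *m invmx g)]); last exact: borel_mulmx.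
rewrite muleA -EFinM mulVf ?gt_eqF// mul1e; congr vol.
by apply/seteqP; split => x /=; rewrite -mulmxA mulmxV// mulmx1.
Qed.

Lemma cons_row_mul m (a : R) w (g : 'M[R]_m) t x :
  cons_row (t, x) *m (block_mx a%:M w 0 g : 'M[R]_(1 + m)) = cons_row (t * a, t *: w + x *m g).
Proof.
by rewrite /cons_row /= (mul_row_block (t%:M : 'M[R]_1)) mulmx0 addr0 -scalar_mxM mul_scalar_mx.
Qed.

(** The map sends the slice at t to the slice at ta by x |-> xg followed by the translation by tw.
    The translation does not change the volume of the slice, and the outer integral contributes
    |a|. *)
Lemma scales_vol_block m (a : R) w (g : 'M[R]_m) : a != 0 -> scales_vol g ->
  scales_vol (block_mx a%:M w 0 g : 'M[R]_(1 + m)).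
Proof.
move=> a0 [c c0 gE]; exists (`|a| * c); first by rewrite mulr_gt0// normr_gt0.
move=> A mA.
have mf : measurable_fun setT (fun t : measurableTypeR R => vol [set x | A (cons_row (t, x))]).
  exact: measurable_fun_section.
have f0 t : (0 <= vol [set x | A (cons_row (t, x))])%E by exact: (measure_ge0 (@vol_measure R m)).
have -> : vol A = (\int[@lebesgue_measure R]_t vol [set x | A (cons_row (t, x))])%E by [].
rewrite (lebesgue_scaling a0 mf f0) EFinM -muleA; congr (_ * _)%E.
rewrite -ge0_integralZl//; first last.
- by rewrite lee_fin ltW.
- by move=> t _; exact: (measure_ge0 (@vol_measure R m)).
- apply: measurable_fun_section; exact: (@borel_mulmx m.+1 m.+1).
apply: eq_integral => t _; rewrite -/vol.
rewrite -(@vol_translate m _ (t *: w)); last exact: measurable_section.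
rewrite gE; last by apply: borel_translate; exact: measurable_section.
congr (_ * vol _)%E; apply/seteqP.
by split => x /=; rewrite -/(cons_row (t, x)) cons_row_mul mulrC addrC.
Qed.

Definition swap_mx m : 'M[R]_m.+2 := perm_mx (tperm 0 1).

Lemma cons_row_swap m s t (x : 'rV[R]_m) :
  cons_row (s, cons_row (t, x)) *m swap_mx m = cons_row (t, cons_row (s, x)).
Proof.
rewrite /swap_mx -[tperm 0 1]tpermV -col_permE; apply/rowP => i; rewrite mxE.
case: (unliftP 0 i) => [j ->|->]; last first.
  by rewrite tpermL (_ : 1 = lift 0 0) ?cons_rowS ?cons_row0//; exact: val_inj.
case: (unliftP 0 j) => [k ->|->]; last first.
  rewrite (_ : lift 0 0 = 1); last exact: val_inj.
  rewrite tpermR (_ : 1 = lift 0 0) ?cons_rowS ?cons_row0//; exact: val_inj.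
by rewrite tpermD// ?cons_rowS.
Qed.

Lemma scales_vol_swap m : scales_vol (swap_mx m).
Proof.
exists 1 => // A mA; rewrite mul1e.
pose f (st : measurableTypeR R * measurableTypeR R) :=
  vol [set x : 'rV[R]_m | A (cons_row (st.1, cons_row (st.2, x)))].
(* Tonelli requires the volume of the section to be measurable jointly in the two first
   coordinates. *)
have mf : measurable_fun setT f.
  pose r (p : (measurableTypeR R * measurableTypeR R) * borel R m) : borel R m.+2 :=
    cons_row (p.1.1, cons_row (p.1.2, p.2)).
  have mr : measurable_fun setT r.
    apply: (measurableT_comp (@measurable_cons_row R m.+1)).
    apply: measurable_fun_pair; first exact: (measurableT_comp measurable_fst measurable_fst).
    apply: (measurableT_comp (@measurable_cons_row R m)).
    apply: measurable_fun_pair => //.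
    exact: (measurableT_comp measurable_snd measurable_fst).
  have := measurable_fun_xsection (@vol_measure R m) (mr measurableT A mA).
  congr measurable_fun; apply/funext => t /=; congr vol; rewrite setTI; apply/seteqP.
  by split => x /=; rewrite /xsection /= ?inE// => Ax; rewrite inE.
have f0 x : (0 <= f x)%E by exact: (measure_ge0 (@vol_measure R m)).
have volE (B : set 'rV[R]_m.+2) : vol B = (\int[@lebesgue_measure R]_s \int[@lebesgue_measure R]_t
  vol [set x : 'rV[R]_m | B (cons_row (s, cons_row (t, x)))])%E by exact: erefl.
rewrite (volE A) (volE [set x | _]).
have := @fubini_tonelli _ _ _ _ _ (@lebesgue_measure R) (@lebesgue_measure R) f mf f0.
rewrite /f /= => ->; apply: eq_integral => t _; apply: eq_integral => s _.
congr vol; apply/seteqP.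
by split => x /=; rewrite cons_row_swap.
Qed.

Lemma scale_pid_mx1 m (b : R) (i : 'I_m.+1) :
  (b *: pid_mx 1 : 'cV[R]_m.+1) i 0 = if i == 0 then b else 0.
Proof. by rewrite !mxE /=; case: i => -[|i] hi /=; rewrite ?mulr1 ?mulr0. Qed.

Lemma ulsubmxE00 m (M : 'M[R]_(1 + m)) : ulsubmx M 0 0 = M 0 0.
Proof. by rewrite !mxE (_ : lshift m 0 = 0)//; exact: val_inj. Qed.

Lemma dlsubmxEi0 m (M : 'M[R]_(1 + m)) i : dlsubmx M i 0 = M (lift 0 i) 0.
Proof.
rewrite !mxE (_ : lshift m 0 = 0); last exact: val_inj.
by rewrite (_ : rshift 1 i = lift 0 i)//; exact: val_inj.
Qed.

(** A first column supported in row 1 is moved to row 0 by the swap, which leaves a block upper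
    triangular matrix. *)
Lemma dlsubmx_swap m (M : 'M[R]_(1 + m.+1)) : M 0 0 = 0 ->
  (forall i : 'I_m.+1, i != 0 -> M (lift 0 i) 0 = 0) ->
  dlsubmx (swap_mx m *m M : 'M[R]_(1 + m.+1)) = 0.
Proof.
move=> M0 Mi; apply/colP => i; rewrite [LHS]dlsubmxEi0 -row_permE mxE [RHS]mxE.
have [->|i0] := eqVneq i 0.
  by rewrite (_ : lift 0 0 = 1) ?tpermR//; exact: val_inj.
rewrite tpermD//; [exact: Mi|].
by rewrite -val_eqE /= eq_sym; apply: contra i0 => /eqP[] /eqP.
Qed.

(* A block upper triangular g is handled by Fubini and induction on m; left
   multiplication by the invertible T and a swap of two coordinates brings any
   other invertible g to that form. *)
Lemma scales_vol_unit m (g : 'M[R]_m) : g \in unitmx -> scales_vol g.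
Proof.
elim: m g => [|m IH] g ug.
  exists 1 => // A mA; rewrite mul1e; congr vol.
  by apply/seteqP; split => x /=; rewrite (thinmx0 (x *m g)) (thinmx0 x).
have block (h : 'M[R]_(1 + m)) : h \in unitmx -> dlsubmx h = 0 -> scales_vol h.
  move=> uh h0; move: uh; rewrite -(submxK h) h0 unitmxE det_ublock unitrM -!unitmxE.
  rewrite [ulsubmx h]mx11_scalar unitmxE det_scalar1 unitfE => /andP[a0 uD].
  by apply: scales_vol_block => //; exact: IH.
have [v0|v0] := eqVneq (dlsubmx (g : 'M[R]_(1 + m))) 0; first exact: block.
case: m => [|m] in g ug IH block v0 *; first by rewrite [dlsubmx _]flatmx0 eqxx in v0.
pose g' : 'M[R]_(1 + m.+1) := g; rewrite -/g' in v0.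
pose v := dlsubmx g'; pose h := invmx (col_ebase v).
have uh : h \in unitmx by rewrite unitmx_inv col_ebase_unit.
pose b := row_ebase v 0 0.
have b0 : b != 0.
  by have := row_ebase_unit v; rewrite [row_ebase v]mx11_scalar unitmxE det_scalar1 unitfE.
have rv : \rank v = 1.
  apply/eqP; rewrite eqn_leq rank_leq_col lt0n mxrank_eq0 v0//.
have hv : h *m v = b *: pid_mx 1.
  rewrite -[X in _ *m X](mulmx_ebase v) !mulmxA mulVmx ?col_ebase_unit// mul1mx rv.
  by rewrite [row_ebase v]mx11_scalar mul_mx_scalar.
pose a := g' 0 0.
(* [h] turns the column v into b times the first unit column; [w] is chosen with w v = -a, so that
   multiplication by T cancels the corner a. The first column of T g is then (0, b, 0, ..., 0). *)
pose w : 'rV_m.+1 := (- a / b) *: (pid_mx 1 *m h).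
have wv : w *m v = (- a)%:M.
  rewrite -scalemxAl -mulmxA hv -scalemxAr scalerA mulfVK// pid_mx_id//.
  by rewrite pid_mx_1 scalemx1.
pose T : 'M[R]_(1 + m.+1) := block_mx 1%:M w 0 h.
have uT : T \in unitmx by rewrite unitmxE det_ublock det1 mul1r -unitmxE.
have sT : scales_vol T by apply: scales_vol_block => //; exact: IH.
pose S : 'M[R]_(1 + m.+1) := swap_mx m.
have uS : S \in unitmx by exact: unitmx_perm.
have Tg (i : 'I_m.+1) : (T *m g') (lift 0 i) 0 = if i == 0 then b else 0.
  rewrite -(dlsubmxEi0 (T *m g')).
  rewrite -(submxK g') mulmx_block block_mxKdl mul0mx add0r -/v hv.
  exact: scale_pid_mx1.
have Tg0 : (T *m g') 0 0 = 0.
  rewrite -(ulsubmxE00 (T *m g')).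
  rewrite -(submxK g') mulmx_block block_mxKul mul1mx -/v wv.
  by rewrite -[g' in ulsubmx g']/g' mxE (ulsubmxE00 g') !mxE subrr.
have sg : scales_vol (S *m (T *m g')).
  apply: block; first by rewrite !unitmx_mul uS uT.
  by apply: dlsubmx_swap => // i /negbTE i0; rewrite Tg i0.
have := scales_vol_mul (scales_vol_mul (scales_vol_inv uT sT) (scales_vol_inv uS (scales_vol_swap m))) sg.
by rewrite -!mulmxA (mulKmx uS) mulKmx.
Qed.

End LinearInvariance.

(** * Euclidean norm *)

Section Euclid.
Variable R : realType.
Implicit Types m : nat.

Definition dotp m (x y : 'rV[R]_m) : R := \sum_i x 0 i * y 0 i.
Definition enorm m (x : 'rV[R]_m) : R := Num.sqrt (dotp x x).

Lemma dotpC m (x y : 'rV[R]_m) : dotp x y = dotp y x.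
Proof. by apply: eq_bigr => i _; rewrite mulrC. Qed.

Lemma dotpDl m (x y z : 'rV[R]_m) : dotp (x + y) z = dotp x z + dotp y z.
Proof. by rewrite -big_split /=; apply: eq_bigr => i _; rewrite mxE mulrDl. Qed.

Lemma dotpZl m a (x z : 'rV[R]_m) : dotp (a *: x) z = a * dotp x z.
Proof. by rewrite mulr_sumr; apply: eq_bigr => i _; rewrite mxE mulrA. Qed.

Lemma dotpNl m (x z : 'rV[R]_m) : dotp (- x) z = - dotp x z.
Proof. by rewrite -scaleN1r dotpZl mulN1r. Qed.

Lemma dotpBl m (x y z : 'rV[R]_m) : dotp (x - y) z = dotp x z - dotp y z.
Proof. by rewrite dotpDl dotpNl. Qed.

Lemma dotpDr m (x y z : 'rV[R]_m) : dotp z (x + y) = dotp z x + dotp z y.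
Proof. by rewrite !(dotpC z) dotpDl. Qed.

Lemma dotpZr m a (x z : 'rV[R]_m) : dotp z (a *: x) = a * dotp z x.
Proof. by rewrite !(dotpC z) dotpZl. Qed.

Lemma dotpBr m (x y z : 'rV[R]_m) : dotp z (x - y) = dotp z x - dotp z y.
Proof. by rewrite !(dotpC z) dotpBl. Qed.

Lemma dotp0l m (x : 'rV[R]_m) : dotp 0 x = 0.
Proof. by rewrite -(scale0r 0) dotpZl mul0r. Qed.

Lemma dotp_suml m I (s : seq I) (F : I -> 'rV[R]_m) z :
  dotp (\sum_(i <- s) F i) z = \sum_(i <- s) dotp (F i) z.
Proof.
elim: s => [|i s IH]; first by rewrite !big_nil dotp0l.
by rewrite !big_cons dotpDl IH.
Qed.

Lemma dotp_ge0 m (x : 'rV[R]_m) : 0 <= dotp x x.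
Proof. by apply: sumr_ge0 => i _; rewrite -expr2 sqr_ge0. Qed.

Lemma dotp_eq0 m (x : 'rV[R]_m) : dotp x x = 0 -> x = 0.
Proof.
move/eqP; rewrite psumr_eq0; last by move=> i _; rewrite -expr2 sqr_ge0.
move=> /allP H; apply/rowP => i; rewrite mxE.
by have := H i (mem_index_enum _); rewrite -expr2 sqrf_eq0 => /eqP.
Qed.

Lemma enorm_ge0 m (x : 'rV[R]_m) : 0 <= enorm x.
Proof. exact: sqrtr_ge0. Qed.

Lemma enorm_sqr m (x : 'rV[R]_m) : enorm x ^+ 2 = dotp x x.
Proof. by rewrite sqr_sqrtr// dotp_ge0. Qed.

Lemma enorm0 m : enorm (0 : 'rV[R]_m) = 0.
Proof. by rewrite /enorm dotp0l sqrtr0. Qed.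

Lemma enorm_eq0 m (x : 'rV[R]_m) : enorm x = 0 -> x = 0.
Proof. by move=> x0; apply: dotp_eq0; rewrite -enorm_sqr x0 expr0n. Qed.

Lemma enorm_gt0 m (x : 'rV[R]_m) : x != 0 -> 0 < enorm x.
Proof.
by move=> x0; rewrite lt_def enorm_ge0 andbT; apply: contra x0 => /eqP/enorm_eq0 ->.
Qed.

Lemma enormZ m a (x : 'rV[R]_m) : enorm (a *: x) = `|a| * enorm x.
Proof. by rewrite /enorm dotpZl dotpZr mulrA -expr2 sqrtrM ?sqr_ge0// sqrtr_sqr. Qed.

Lemma enormN m (x : 'rV[R]_m) : enorm (- x) = enorm x.
Proof. by rewrite -scaleN1r enormZ normrN1 mul1r. Qed.

(** Cauchy-Schwarz: the squared length of |y| x - |x| y is 2 |x| |y| (|x| |y| - <x, y>). *)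
Lemma dotp_le m (x y : 'rV[R]_m) : dotp x y <= enorm x * enorm y.
Proof.
have [->|x0] := eqVneq x 0; first by rewrite dotp0l mulr_ge0// enorm_ge0.
have [->|y0] := eqVneq y 0; first by rewrite dotpC dotp0l mulr_ge0// enorm_ge0.
have a0 := enorm_gt0 x0; have b0 := enorm_gt0 y0.
have := dotp_ge0 (enorm y *: x - enorm x *: y).
rewrite dotpBl !dotpBr !dotpZl !dotpZr -!enorm_sqr (dotpC y x).
set a := enorm x in a0 *; set b := enorm y in b0 *; set c := dotp x y => H.
have : 0 <= (2 * (a * b)) * (a * b - c).
  by move: H; congr (_ <= _); ring.
by rewrite pmulr_rge0 ?subr_ge0// !mulr_gt0.
Qed.

Lemma abs_dotp_le m (x y : 'rV[R]_m) : `|dotp x y| <= enorm x * enorm y.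
Proof.
rewrite ler_norml dotp_le andbT lerNl -dotpNl.
by apply: le_trans (dotp_le _ _) _; rewrite enormN.
Qed.

Lemma enormD m (x y : 'rV[R]_m) : enorm (x + y) <= enorm x + enorm y.
Proof.
rewrite -ler_sqr ?nnegrE ?addr_ge0 ?enorm_ge0// enorm_sqr dotpDl !dotpDr (dotpC y x).
have := dotp_le x y; rewrite -!enorm_sqr => H.
have -> : (enorm x + enorm y) ^+ 2 = enorm x ^+ 2 + enorm x * enorm y + (enorm x * enorm y + enorm y ^+ 2) by ring.
lra.
Qed.

Lemma enorm_sum m I (s : seq I) (F : I -> 'rV[R]_m) :
  enorm (\sum_(i <- s) F i) <= \sum_(i <- s) enorm (F i).
Proof.
elim: s => [|i s IH]; first by rewrite !big_nil enorm0.
by rewrite !big_cons (le_trans (enormD _ _))// lerD2l.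
Qed.

Lemma coord_le_enorm m (x : 'rV[R]_m) i : `|x 0 i| <= enorm x.
Proof.
rewrite -ler_sqr ?nnegrE ?enorm_ge0// enorm_sqr real_normK ?num_real//.
rewrite /dotp (bigD1 i)//= -expr2 lerDl; apply: sumr_ge0 => k _.
by rewrite -expr2 sqr_ge0.
Qed.

Lemma enorm_le_sum m (x : 'rV[R]_m) : enorm x <= \sum_i `|x 0 i|.
Proof.
rewrite {1}(row_sum_delta x); apply: le_trans (enorm_sum _ _) _.
apply: ler_sum => i _; rewrite enormZ /enorm /dotp (bigD1 i)//= big1 => [|k ki].
  by rewrite !mxE !eqxx mulr1 addr0 sqrtr1 mulr1.
by rewrite !mxE (negbTE ki) andbF mulr0.
Qed.

Lemma dotp_mulmx m n (x : 'rV[R]_m) (y : 'rV[R]_n) g :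
  dotp (x *m g) y = dotp x (y *m g^T).
Proof.
have dE k (a b : 'rV[R]_k) : dotp a b = (a *m b^T) 0 0.
  by rewrite mxE; apply: eq_bigr => i _; rewrite mxE.
by rewrite !dE trmx_mul trmxK mulmxA.
Qed.

Lemma enorm_isometry m n (x : 'rV[R]_m) (U : 'M[R]_(m, n)) :
  U *m U^T = 1%:M -> enorm (x *m U) = enorm x.
Proof. by move=> UU; rewrite /enorm dotp_mulmx -mulmxA UU mulmx1. Qed.

Lemma dotp_isometry m n (x y : 'rV[R]_m) (U : 'M[R]_(m, n)) :
  U *m U^T = 1%:M -> dotp (x *m U) (y *m U) = dotp x y.
Proof. by move=> UU; rewrite dotp_mulmx -mulmxA UU mulmx1. Qed.

Lemma ortho_tr m (U : 'M[R]_m) : U *m U^T = 1%:M -> U^T *m U = 1%:M.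
Proof. by move/mulmx1C. Qed.

Lemma ortho_unit m (U : 'M[R]_m) : U *m U^T = 1%:M -> U \in unitmx.
Proof. by move/mulmx1_unit => []. Qed.

Lemma eballE m (x : 'rV[R]_m) : eball x <-> enorm x <= 1.
Proof.
rewrite /eball /= (_ : \sum_i _ = dotp x x); last by apply: eq_bigr => i _; rewrite expr2.
by rewrite -enorm_sqr expr_le1// enorm_ge0.
Qed.

Lemma dotp_continuous m (y : 'rV[R]_m) : continuous (fun x : 'rV[R]_m => dotp x y).
Proof.
have ck k : continuous (fun x : 'rV[R]_m => x 0 k) by exact: coord_continuous.
apply: sum_continuous => k x.
by apply: (@continuousM _ _ (fun x : 'rV[R]_m => x 0 k) (fun=> y 0 k)); [exact: ck|exact: cst_continuous].
Qed.

Lemma enorm_continuous m : continuous (@enorm m).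
Proof.
have ck k : continuous (fun x : 'rV[R]_m => x 0 k) by exact: coord_continuous.
move=> x; apply: continuous_comp; last exact: sqrt_continuous.
apply: sum_continuous => k z.
by apply: (@continuousM _ _ (fun x : 'rV[R]_m => x 0 k) (fun x : 'rV[R]_m => x 0 k)); exact: ck.
Qed.

Lemma closed_le_continuous (T : topologicalType) (f : T -> R) c :
  continuous f -> closed [set x | f x <= c].
Proof.
move=> cf; rewrite (_ : [set _ | _] = f @^-1` [set x | x <= c])//.
by apply: preimage_closed; [move=> x _; exact: cf|exact: closed_le].
Qed.

Lemma closed_eball m : closed (@eball R m).
Proof.
rewrite (_ : @eball R m = [set x | @enorm m x <= 1]); first exact/closed_le_continuous/enorm_continuous.
by apply/seteqP; split => x /eballE.
Qed.

Lemma bounded_enorm_compact m (A : set 'rV[R]_m) (M : R) :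
  closed A -> (forall x, A x -> enorm x <= M) -> compact A.
Proof.
move=> cA AM; apply: bounded_closed_compact => //.
exists M; split; first exact: num_real.
move=> M' MM' x Ax; apply: (@le_trans _ _ M); last exact: ltW.
rewrite [leLHS]/Num.norm /= mx_normrE; apply/bigmax_leP; split => /=.
  exact: le_trans (enorm_ge0 _) (AM x Ax).
by move=> [i j] _ /=; rewrite ord1; apply: le_trans (coord_le_enorm _ _) (AM x Ax).
Qed.

Lemma compact_enorm_bounded m (A : set 'rV[R]_m) : compact A ->
  exists2 M : R, 0 < M & forall x, A x -> enorm x <= M.
Proof.
move=> cA; have [A0|/set0P/negP/negPn/eqP ->] := pselect (A !=set0); last by exists 1.
have [c Ac cM] := @EVT_max_rV R m (@enorm m) A A0 cA (continuous_subspaceT (@enorm_continuous m)).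
exists (enorm c + 1); first by rewrite ltr_wpDl// enorm_ge0.
by move=> x Ax; rewrite (le_trans (cM x _))// ?inE// lerDl.
Qed.

Lemma compact_eball m : compact (@eball R m).
Proof. by apply: (@bounded_enorm_compact _ _ 1) => [|x /eballE]; first exact: closed_eball. Qed.

Lemma convex_eball m (x y : 'rV[R]_m) (t : R) : 0 <= t -> t <= 1 ->
  eball x -> eball y -> eball (t *: x + (1 - t) *: y).
Proof.
move=> t0 t1 /eballE x1 /eballE y1; apply/eballE; apply: le_trans (enormD _ _) _.
have t1' : 0 <= 1 - t by rewrite subr_ge0.
rewrite !enormZ !ger0_norm//.
apply: (@le_trans _ _ (t * 1 + (1 - t) * 1)); last by rewrite !mulr1 addrC subrK.
by rewrite lerD// ler_wpM2l.
Qed.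

Lemma borel_compact m (A : set 'rV[R]_m) : compact A -> measurable (A : set (borel R m)).
Proof. by move=> cA; apply: closed_borel; apply: compact_closed => //; exact: (@norm_hausdorff R 'rV[R]_m). Qed.

Lemma vol_ge0 m (A : set 'rV[R]_m) : (0 <= vol A)%E.
Proof. exact: (measure_ge0 (@vol_measure R m)). Qed.

Lemma closed_box m (l u : 'I_m -> R) : closed [set x : 'rV[R]_m | forall i, l i <= x 0 i <= u i].
Proof.
have -> : [set x : 'rV[R]_m | forall i, l i <= x 0 i <= u i] = \bigcap_i ([set x : 'rV[R]_m | x 0 i <= u i] `&` [set x : 'rV[R]_m | - x 0 i <= - l i]).
  apply/seteqP; split => x /= H i.
    by move=> _ /=; rewrite lerN2; case/andP: (H i).
  by have [/= -> +] := H i I; rewrite lerN2 => ->.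
apply: closed_bigI => i _; apply: closedI; apply: closed_le_continuous => x.
  exact: coord_continuous.
by apply: continuousN; exact: coord_continuous.
Qed.

Lemma vol_bounded m (A : set 'rV[R]_m) (M : R) : measurable (A : set (borel R m)) ->
  0 <= M -> (forall x, A x -> enorm x <= M) -> vol A \is a fin_num.
Proof.
move=> mA M0 AM; rewrite ge0_fin_numE ?vol_ge0//.
apply: (@le_lt_trans _ _ (vol [set x : 'rV[R]_m | forall i, (- M <= x 0 i <= M)%R])).
  apply: vol_le => //; first by apply: closed_borel; apply: closed_box.
  by move=> x Ax i; rewrite -ler_norml (le_trans (coord_le_enorm _ _))// AM.
by rewrite vol_box ?ltry// => i; rewrite (@le_trans _ _ 0)// oppr_le0.
Qed.

Lemma vol_compact_fin m (A : set 'rV[R]_m) : compact A -> vol A \is a fin_num.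
Proof.
move=> cA; have [M M0 AM] := compact_enorm_bounded cA.
by apply: (vol_bounded (borel_compact cA) (ltW M0) AM).
Qed.

Lemma vol_eball_gt0 m : (0 < vol (@eball R m))%E.
Proof.
(* A cube of side 1/(m+1), rather than 1/m, lies in the ball also for m = 0. *)
apply: (@lt_le_trans _ _ (vol [set x : 'rV[R]_m | forall i, (0 <= x 0 i <= m.+1%:R^-1)%R])).
  rewrite vol_box; last by move=> i; rewrite invr_ge0.
  by rewrite lte_fin prodr_gt0// => i _; rewrite subr0 invr_gt0.
apply: vol_le; first by apply: closed_borel; apply: closed_box.
  by apply: closed_borel; apply: closed_eball.
move=> x H; apply/eballE; apply: le_trans (enorm_le_sum _) _.
apply: (@le_trans _ _ (\sum_(i < m) m.+1%:R^-1)).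
  by apply: ler_sum => i _; have /andP[x0 x1] := H i; rewrite ger0_norm.
rewrite sumr_const card_ord -[_ *+ m]mulr_natl ler_pdivrMr ?ltr0n// mul1r ler_nat; exact: leqnSn.
Qed.

(** The scaling constant is 1 because the unit ball is its own preimage and has positive finite
    volume. *)
Lemma vol_ortho m (A : set 'rV[R]_m) (U : 'M[R]_m) : measurable (A : set (borel R m)) ->
  U *m U^T = 1%:M -> vol [set x | A (x *m U)] = vol A.
Proof.
move=> mA UU; have [c c0 cE] := scales_vol_unit (ortho_unit UU).
suff c1 : c = 1 by rewrite (cE A mA) c1 mul1e.
have := cE _ (borel_compact (@compact_eball m)).
rewrite (_ : [set x | _] = @eball R m); last first.
  by apply/seteqP; split => x /=; rewrite !eballE enorm_isometry.
have := vol_eball_gt0 m; have := vol_compact_fin (@compact_eball m).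
case: (vol (@eball R m)) => //= r _; rewrite lte_fin => r0 [] /esym/eqP.
by rewrite -subr_eq0 -{2}(mul1r r) -mulrBl mulf_eq0 (gt_eqF r0) orbF subr_eq0 => /eqP.
Qed.

(** The scaling constant is found on the unit cube, whose preimage has side 1/t. *)
Lemma vol_scale m (A : set 'rV[R]_m) (t : R) : measurable (A : set (borel R m)) ->
  0 < t -> vol A = ((t ^+ m)%:E * vol [set x | A (t *: x)])%E.
Proof.
move=> mA t0.
have ut : (t%:M : 'M[R]_m) \in unitmx by rewrite unitmxE det_scalar unitrX// unitfE gt_eqF.
have [c c0 cE] := scales_vol_unit ut.
have E (B : set 'rV[R]_m) : [set x | B (x *m t%:M)] = [set x | B (t *: x)].
  by apply/seteqP; split => x /=; rewrite mul_mx_scalar.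
suff <- : c = t ^+ m by rewrite -E; exact: cE.
have /cE : measurable ([set x : 'rV[R]_m | forall i, (0 <= x 0 i <= 1)%R] : set (borel R m)).
  by apply: closed_borel; apply: closed_box.
have -> : [set x : 'rV[R]_m | [set x0 : 'rV[R]_m | forall i, (0 <= x0 0 i <= 1)%R] (x *m t%:M)] =
    [set x : 'rV[R]_m | forall i, (0 <= x 0 i <= t^-1)%R].
  by apply/seteqP; split => x /= H i; have := H i;
    rewrite mul_mx_scalar mxE pmulr_rge0// -[t^-1]mulr1 ler_pdivlMl.
rewrite !vol_box//; last by move=> i; rewrite invr_ge0 ltW.
rewrite !prodr_const card_ord !subr0 expr1n -EFinM exprVn => -[] H.
by rewrite -(mul1r (t ^+ m)) H mulfVK// expf_neq0// gt_eqF.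
Qed.

End Euclid.

(** * Adding segments to convex sets *)

Section Zonotope.
Variable R : realType.

(** Interior points are not asked for: segments, zonotopes, projections and flat boxes have to
    qualify. *)
Definition cconv m (K : set 'rV[R]_m) := compact K /\
  forall x y (t : R), 0 <= t -> t <= 1 -> K x -> K y -> K (t *: x + (1 - t) *: y).

Definition msum m (A B : set 'rV[R]_m) : set 'rV[R]_m := [set x + y | x in A & y in B].

Definition seg m (v : 'rV[R]_m) : set 'rV[R]_m := [set t *: v | t in [set t : R | `|t| <= 1]].

Fixpoint zono m (lam : R) (s : seq 'rV[R]_m) : set 'rV[R]_m :=
  if s is v :: s' then msum (seg (lam *: v)) (zono lam s') else [set 0].

Lemma cconv_eball m : cconv (@eball R m).
Proof. by split; [exact: compact_eball|move=> *; exact: convex_eball]. Qed.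

Lemma msumC m (A B : set 'rV[R]_m) : msum A B = msum B A.
Proof. by apply/seteqP; split => x [a Aa [b Bb <-]]; exists b => //; exists a => //; rewrite addrC. Qed.

Lemma msumA m (A B C : set 'rV[R]_m) : msum A (msum B C) = msum (msum A B) C.
Proof.
apply/seteqP; split => x.
  move=> [a Aa [_ [b Bb [c Cc <-]] <-]]; exists (a + b); first by exists a => //; exists b.
  by exists c => //; rewrite addrA.
move=> [_ [a Aa [b Bb <-]] [c Cc <-]]; exists a => //; exists (b + c); last by rewrite addrA.
by exists b => //; exists c.
Qed.

Lemma msum0 m (A : set 'rV[R]_m) : msum A [set 0] = A.
Proof.
apply/seteqP; split => x; first by move=> [a Aa [_ -> <-]]; rewrite addr0.
by move=> Ax; exists x => //; exists 0 => //; rewrite addr0.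
Qed.

Lemma msum_subset m (A B C D : set 'rV[R]_m) : A `<=` B -> C `<=` D -> msum A C `<=` msum B D.
Proof. by move=> AB CD x [a Aa [c Cc <-]]; exists a; [exact: AB|exists c => //; exact: CD]. Qed.

Lemma compact_image m n (f : 'rV[R]_m -> 'rV[R]_n) (A : set 'rV[R]_m) :
  continuous f -> compact A -> compact (f @` A).
Proof. by move=> cf; apply: continuous_compact; exact: continuous_subspaceT. Qed.

Lemma cconv_msum m (A B : set 'rV[R]_m) : cconv A -> cconv B -> cconv (msum A B).
Proof.
move=> [cA vA] [cB vB]; split.
  have -> : msum A B = (fun p : 'rV[R]_m * 'rV[R]_m => p.1 + p.2) @` (A `*` B).
    apply/seteqP; split => x; first by move=> [a Aa [b Bb <-]]; exists (a, b).
    by move=> [[a b] [/= Aa Bb] <-]; exists a => //; exists b.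
  apply: continuous_compact; last exact: compact_setX.
  by apply: continuous_subspaceT; exact: add_continuous.
move=> _ _ t t0 t1 [a Aa [b Bb <-]] [a' Aa' [b' Bb' <-]].
exists (t *: a + (1 - t) *: a'); first exact: vA.
by exists (t *: b + (1 - t) *: b'); [exact: vB|rewrite !scalerDr addrACA].
Qed.

Lemma cconv_mulmx m n (P : 'M[R]_(m, n)) (A : set 'rV[R]_m) :
  cconv A -> cconv [set x *m P | x in A].
Proof.
move=> [cA vA]; split; first by apply: compact_image => //; exact: mulmx_continuous.
move=> _ _ t t0 t1 [a Aa <-] [b Ab <-]; exists (t *: a + (1 - t) *: b); first exact: vA.
by rewrite mulmxDl -!scalemxAl.
Qed.

Lemma cconv_seg m (v : 'rV[R]_m) : cconv (seg v).
Proof.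
have -> : seg v = [set x *m v | x in [set x : 'rV[R]_1 | forall i, -1 <= x 0 i <= 1]].
  apply/seteqP; split => x [t t1 <-].
    exists t%:M; last by rewrite mul_scalar_mx.
    by move=> i; rewrite (ord1 i) mxE eqxx -ler_norml.
  exists (t 0 0); first by rewrite /= ler_norml; exact: t1.
  by rewrite {2}[t]mx11_scalar mul_scalar_mx.
apply: cconv_mulmx; split.
  apply: (@bounded_enorm_compact _ _ _ 1); first exact: closed_box.
  move=> x H; rewrite (le_trans (enorm_le_sum x))// big_ord_recl big_ord0 addr0.
  by rewrite ler_norml; exact: H.
move=> x y t t0 t1 Hx Hy i; rewrite !mxE -ler_norml.
have t1' : 0 <= 1 - t by rewrite subr_ge0.
have := Hx i; have := Hy i; rewrite -!ler_norml => Hx' Hy'.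
apply: le_trans (ler_normD _ _) _; rewrite !normrM (ger0_norm t0) (ger0_norm t1').
have : t * `|x 0 i| <= t * 1 by rewrite ler_wpM2l.
have : (1 - t) * `|y 0 i| <= (1 - t) * 1 by rewrite ler_wpM2l ?subr_ge0.
lra.
Qed.

Lemma cconv_set1 m (v : 'rV[R]_m) : cconv [set v].
Proof.
split; first exact: compact_set1.
by move=> x y t t0 t1 -> ->; rewrite -scalerDl addrC subrK scale1r.
Qed.

Lemma cconv_zono m lam (s : seq 'rV[R]_m) : cconv (zono lam s).
Proof.
elim: s => [|v s IH] /=; first exact: cconv_set1.
by apply: cconv_msum => //; exact: cconv_seg.
Qed.

Lemma image_msum m n (P : 'M[R]_(m, n)) (A B : set 'rV[R]_m) :
  [set x *m P | x in msum A B] = msum [set x *m P | x in A] [set x *m P | x in B].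
Proof.
apply/seteqP; split => x.
  move=> [_ [a Aa [b Bb <-]] <-]; exists (a *m P); first by exists a.
  by exists (b *m P); [exists b|rewrite mulmxDl].
move=> [_ [a Aa <-] [_ [b Bb <-] <-]]; exists (a + b); last by rewrite mulmxDl.
by exists a => //; exists b.
Qed.

Lemma image_seg m n (P : 'M[R]_(m, n)) v : [set x *m P | x in seg v] = seg (v *m P).
Proof.
apply/seteqP; split => x.
  by move=> [_ [t t1 <-] <-]; exists t => //; rewrite scalemxAl.
by move=> [t t1 <-]; exists (t *: v); [exists t|rewrite scalemxAl].
Qed.

Lemma image_zono m n (P : 'M[R]_(m, n)) lam s :
  [set x *m P | x in zono lam s] = zono lam [seq v *m P | v <- s].
Proof.
elim: s => [|v s IH] /=; first by rewrite image_set1 mul0mx.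
by rewrite image_msum image_seg IH scalemxAl.
Qed.

Lemma compact_convex_R (I : set R) : compact I -> I !=set0 ->
  (forall x y t : R, 0 <= t -> t <= 1 -> I x -> I y -> I (t * x + (1 - t) * y)) ->
  exists a b, a <= b /\ I = `[a, b]%classic.
Proof.
move=> cI I0 vI.
have cid : {within I, continuous (fun x : R => x)}.
  by apply: continuous_subspaceT => x; exact: cvg_id.
have [b Ib bM] := compact_EVT_max I0 cI cid.
have [a Ia am] := compact_EVT_min I0 cI cid.
exists a, b; split; first exact: am.
apply/seteqP; split => x.
  by move=> Ix; rewrite /= in_itv /= am ?bM// inE.
rewrite /= in_itv /= => /andP[ax xb].
rewrite inE in Ia; rewrite inE in Ib.
have [ab|ab] := eqVneq a b; first by have -> : x = a by apply/le_anti; rewrite ax andbT ab.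
have ab' : 0 < b - a by rewrite subr_gt0 lt_neqAle ab (le_trans ax xb).
have -> : x = ((x - a) / (b - a)) * b + (1 - (x - a) / (b - a)) * a.
  by field; rewrite gt_eqF.
apply: vI => //; first by rewrite divr_ge0 ?subr_ge0// ltW// -subr_gt0.
by rewrite ler_pdivrMr// mul1r lerD2r.
Qed.

(** [vol] keeps the first coordinate for the outermost integral. Uniqueness of the product measure
    brings it innermost, so that a segment along e_0 can be added line by line. *)
Lemma vol_prod2 m (A : set 'rV[R]_m.+1) : measurable (A : set (borel R m.+1)) ->
  vol A = (\int[@vol_measure R m]_y
    (@lebesgue_measure R) [set t | A (cons_row (t, y))])%E.
Proof.
move=> mA; rewrite vol_prod.
have mX : measurable (@cons_row R m @^-1` A : set (measurableTypeR R * borel R m)).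
  by have := @measurable_cons_row R m measurableT _ mA; rewrite setTI.
rewrite (@product_measure_unique _ _ _ _ _ (@lebesgue_measure R) (@vol_measure R m)
  (@lebesgue_measure R \x^ @vol_measure R m)%E)//; last first.
  by move=> B C mB mC; exact: product_measure2E.
apply: eq_integral => y _ /=; congr (@lebesgue_measure R _).
by apply/seteqP; split => t /=; rewrite /ysection /= ?inE// => Ax; rewrite inE.
Qed.

Definition row_e0 m : 'rV[R]_m.+1 := cons_row (1, 0).

Definition behead_mx m : 'M[R]_(m.+1, m) := col_mx (0 : 'rV[R]_m) 1%:M.

Lemma cons_row_behead m (p : R * 'rV[R]_m) : cons_row p *m behead_mx m = p.2.
Proof. by rewrite /cons_row /behead_mx (mul_row_col (p.1%:M : 'M[R]_1)) mulmx0 add0r mulmx1. Qed.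

Lemma cons_rowZ m a (p : R * 'rV[R]_m) : a *: cons_row p = cons_row (a * p.1, a *: p.2).
Proof.
apply/rowP => i; rewrite mxE.
by case: (unliftP 0 i) => [j ->|->]; rewrite ?cons_rowS ?cons_row0 //= mxE.
Qed.

Lemma cons_row_continuous m (y : 'rV[R]_m) : continuous (fun t : R => cons_row (t, y)).
Proof.
apply: rV_continuous => i; case: (unliftP 0 i) => [j ->|->].
  by under eq_fun do rewrite cons_rowS; exact: cst_continuous.
by under eq_fun do rewrite cons_row0; move=> t; exact: cvg_id.
Qed.

Lemma seg_e0P m (s : R) (x : 'rV[R]_m.+1) : 0 <= s ->
  seg (s *: row_e0 m) x <-> exists2 t, `|t| <= s & x = cons_row (t, 0).
Proof.
move=> s0; split.
  move=> [u /= u1 <-]; exists (u * s).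
    by rewrite normrM (ger0_norm s0) ler_piMl.
  by rewrite /row_e0 !cons_rowZ /= mulr1 !scaler0.
move=> [t ts ->]; have [s_0|s_0] := eqVneq s 0.
  exists 0; first by rewrite /= normr0.
  by move: ts; rewrite s_0 normr_le0 => /eqP ->; rewrite scale0r -(scale0r (cons_row (0, 0))) cons_rowZ mul0r scale0r.
have s1 : 0 < s by rewrite lt_def s_0.
exists (t / s); first by rewrite /= normrM normfV (ger0_norm s0) ler_pdivrMr// mul1r.
by rewrite /row_e0 !cons_rowZ /= mulr1 !scaler0 mulfVK.
Qed.

(* A line parallel to e_0 that meets K meets it in a segment, which becomes
   longer by 2 s; the other lines still miss the sum. *)
Lemma vol_seg_e0 m (K : set 'rV[R]_m.+1) (s : R) : cconv K -> 0 <= s ->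
  vol (msum K (seg (s *: row_e0 m))) =
  (vol K + (s * 2)%:E * vol [set x *m behead_mx m | x in K])%E.
Proof.
move=> KK s0; have [cK vK] := KK.
have KS : cconv (msum K (seg (s *: row_e0 m))) by apply: cconv_msum => //; exact: cconv_seg.
have PK : cconv [set x *m behead_mx m | x in K] by exact: cconv_mulmx.
have mPK := borel_compact PK.1.
have mK := borel_compact cK; have mKS := borel_compact KS.1.
rewrite !vol_prod2//.
have -> : vol [set x *m behead_mx m | x in K] =
    (\int[@vol_measure R m]_y (\1_[set x *m behead_mx m | x in K] y)%:E)%E.
  by rewrite integral_indic// setIT.
have msec (A : set 'rV[R]_m.+1) : measurable (A : set (borel R m.+1)) ->
    measurable_fun setT (fun y : borel R m => (@lebesgue_measure R) [set t | A (cons_row (t, y))]).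
  move=> mA.
  have mX : measurable (@cons_row R m @^-1` A : set (measurableTypeR R * borel R m)).
    by have := @measurable_cons_row R m measurableT _ mA; rewrite setTI.
  have := measurable_fun_ysection (@lebesgue_measure R) mX.
  congr measurable_fun; apply/funext => y /=; congr (@lebesgue_measure R _).
  by apply/seteqP; split => t /=; rewrite /ysection /= ?inE// => Ax; rewrite inE.
rewrite -ge0_integralZl//; first last.
- by rewrite lee_fin mulr_ge0.
- by apply/measurable_EFinP; exact: measurable_indic.
rewrite -ge0_integralD//; first last.
- by apply: measurable_funeM; apply/measurable_EFinP; exact: measurable_indic.
- by move=> y _; rewrite mule_ge0// lee_fin ?mulr_ge0.
- exact: msec.
apply: eq_integral => y _.
rewrite indicE; case: (boolP (y \in _)) => [|yK].
  rewrite inE => -[x Kx xy].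
  pose I : set R := [set t | K (cons_row (t, y))].
  have [p px] := cons_row_surj x.
  have [a [b [ab Iab]]] : exists a b, a <= b /\ I = `[a, b]%classic.
    apply: compact_convex_R.
    - have [M M0 KM] := compact_enorm_bounded cK.
      apply: (@subclosed_compact _ _ `[- M, M]%classic); last first.
      + move=> t It; rewrite /= in_itv /= -ler_norml.
        by have := coord_le_enorm (cons_row (t, y)) 0; rewrite cons_row0 => /le_trans; apply; exact: KM.
      + exact: segment_compact.
      rewrite /I; apply: (@preimage_closed _ _ (fun t => cons_row (t, y))).
        by move=> t _; exact: cons_row_continuous.
      by apply: compact_closed => //; exact: (@norm_hausdorff R 'rV[R]_m.+1).
    - by exists p.1; rewrite /I /= -xy px cons_row_behead -surjective_pairing -px.
    - move=> u v t t0 t1 Iu Iv; rewrite /I /=.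
      have := vK _ _ t t0 t1 Iu Iv; congr K.
      apply/rowP => i; rewrite mxE [X in X + _]mxE [X in _ + X]mxE.
      by case: (unliftP 0 i) => [k ->|->]; rewrite ?cons_rowS ?cons_row0 //=; ring.
  rewrite -/I Iab.
  have -> : [set t | msum K (seg (s *: row_e0 m)) (cons_row (t, y))] = `[a - s, b + s]%classic.
    apply/seteqP; split => t.
      move=> [k Kk [_ /(seg_e0P _ s0)[u us ->]]]; have [[k1 k2] kE] := cons_row_surj k.
      rewrite kE cons_rowD => /cons_row_inj [<- yE].
      have : I k1 by rewrite /I /= -yE addr0 -kE.
      rewrite Iab /= !in_itv /= => /andP[ak kb]; move: us; rewrite ler_norml => /andP[us1 us2].
      by apply/andP; split; lra.
    rewrite /= in_itv /= => /andP[at_ tb].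
    (* u is the point of [a, b] nearest to t. *)
    have [u Iu ut] : exists2 u, I u & `|t - u| <= s.
      rewrite Iab; have [ta|ta] := ltP t a.
        by exists a; rewrite /= ?in_itv /= ?lexx// ler_norml; apply/andP; split; lra.
      have [bt|bt] := ltP b t.
        by exists b; rewrite /= ?in_itv /= ?lexx ?andbT// ler_norml; apply/andP; split; lra.
      by exists t; rewrite /= ?in_itv /= ?ta// subrr normr0.
    exists (cons_row (u, y)) => //; exists (cons_row (t - u, 0)).
      by apply/(seg_e0P _ s0); exists (t - u).
    by rewrite cons_rowD; congr cons_row; rewrite -[RHS]/(_, _); congr pair; rewrite /= ?addr0// addrC subrK.
  rewrite !lebesgue_measure_itv /= !lte_fin mule1.
  case: ltP => [H1|H1]; case: ltP => [H2|H2]; rewrite -?EFinD ?add0e; congr EFin; lra.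
rewrite mule0 adde0; congr (@lebesgue_measure R _).
apply/seteqP; split => t.
  move=> [k Kk [_ /(seg_e0P _ s0)[u us ->]]]; have [[k1 k2] kE] := cons_row_surj k.
  rewrite kE cons_rowD => /cons_row_inj [_ yE].
  move: yK; rewrite notin_setE; case; exists k => //.
  by rewrite kE cons_row_behead -yE addr0.
move=> Kt; move: yK; rewrite notin_setE; case; exists (cons_row (t, y)) => //.
by rewrite cons_row_behead.
Qed.

(** A change of variables g with e_0 g = v reduces this to [vol_seg_e0]. It matters that d and P
    depend on v alone: the added term is then monotone in K and linear in lam. *)
Lemma vol_seg m (v : 'rV[R]_m.+1) : exists2 d : R, 0 <= d & exists P : 'M[R]_(m.+1, m),
  forall (K : set 'rV[R]_m.+1) (lam : R), cconv K -> 0 <= lam ->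
  vol (msum K (seg (lam *: v))) = (vol K + (lam * d)%:E * vol [set x *m P | x in K])%E.
Proof.
have [->|v0] := eqVneq v 0.
  exists 0 => //; exists 0 => K lam KK lam0.
  rewrite mulr0 mul0e adde0 scaler0; congr vol.
  rewrite -{2}(msum0 K); congr msum; apply/seteqP; split => x; first by move=> [t _ <-]; rewrite scaler0.
  by move=> ->; exists 0; rewrite ?scale0r//= normr0.
have [g ug gE] : exists2 g : 'M[R]_m.+1, g \in unitmx & row_e0 m *m g = v.
  have rv : \rank v = 1.
    by apply/eqP; rewrite eqn_leq rank_leq_row lt0n mxrank_eq0 v0.
  pose b := col_ebase v 0 0.
  have b0 : b != 0.
    by have := col_ebase_unit v; rewrite [col_ebase v]mx11_scalar unitmxE det_scalar1 unitfE.
  (* A nonzero row v is b times the first row of the invertible matrix [row_ebase v]. *)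
  exists (b *: row_ebase v); first by rewrite unitmxZ ?unitfE// row_ebase_unit.
  rewrite -scalemxAr scalemxAl -[RHS](mulmx_ebase v); congr (_ *m _).
  rewrite [col_ebase v]mx11_scalar mul_scalar_mx -/b rv; congr (_ *: _).
  apply/rowP => i; rewrite /row_e0.
  by case: (unliftP 0 i) => [j ->|->]; rewrite ?cons_rowS ?cons_row0 //= !mxE.
have [c c0 cE] := scales_vol_unit ug.
exists (c * 2); first by rewrite mulr_ge0// ltW.
exists (invmx g *m behead_mx m) => K lam KK lam0.
have gK (A : set 'rV[R]_m.+1) : [set x | A (x *m g)] = [set x *m invmx g | x in A].
  apply/seteqP; split => x /=; first by move=> Ax; exists (x *m g) => //; rewrite mulmxK.
  by move=> [y Ay <-]; rewrite mulmxKV.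
have KS : cconv (msum K (seg (lam *: v))) by apply: cconv_msum => //; exact: cconv_seg.
rewrite (cE _ (borel_compact KS.1)) (cE _ (borel_compact KK.1)) !gK image_msum image_seg.
rewrite -scalemxAl -gE mulmxK// vol_seg_e0//; last exact: cconv_mulmx.
rewrite ge0_muleDr ?vol_ge0//; last first.
  by rewrite mule_ge0 ?vol_ge0// lee_fin mulr_ge0.
rewrite muleA -EFinM (_ : c * (lam * 2) = lam * (c * 2)); last by ring.
congr (_ + _ * vol _)%E; apply/seteqP; split => x.
  by move=> [_ [y Ky <-] <-]; exists y => //; rewrite mulmxA.
by move=> [y Ky <-]; exists (y *m invmx g); [exists y|rewrite mulmxA].
Qed.

(** Peeling off one segment leaves the volume of K plus a shorter zonotope, and lam d times the
    volume of its projection, which is again a convex set plus a zonotope, one dimension lower.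
    Hence the induction is on the number of segments, for all dimensions at once. *)
Lemma vol_zono m (s : seq 'rV[R]_m) : exists c : nat -> set 'rV[R]_m -> R,
  [/\ forall i K, cconv K -> 0 <= c i K,
      forall i K L, cconv K -> cconv L -> K `<=` L -> c i K <= c i L &
      forall K (lam : R), cconv K -> 0 <= lam ->
        vol (msum K (zono lam s)) = (\sum_(i < m.+1) c i K * lam ^+ i)%:E].
Proof.
have [N] := ubnP (size s); elim: N m s => // N IH m [|v s] sN.
  exists (fun i K => if i == 0%N then fine (vol K) else 0); split => //.
  - by move=> [|i] K KK //=; rewrite fine_ge0// vol_ge0.
  - move=> [|i] K L KK LL KL //=; rewrite fine_le ?vol_compact_fin//; [exact: KK.1|exact: LL.1|].
    by apply: vol_le => //; apply: borel_compact; [exact: KK.1|exact: LL.1].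
  - move=> K lam KK lam0; rewrite /= msum0 big_ord_recl /= expr0 mulr1 big1 ?addr0.
      by rewrite fineK// vol_compact_fin//; exact: KK.1.
    by move=> i _; rewrite mul0r.
have [c1 [c1_ge0 c1_le c1E]] := IH m s sN.
case: m => [|m] in v s sN c1 c1_ge0 c1_le c1E *.
  (* In dimension 0 every segment is {0} and there is nothing to project. *)
  exists c1; split => // K lam KK lam0; rewrite -c1E//; congr vol.
  rewrite [zono _ (_ :: _)]/= msumA (_ : seg _ = [set 0]) ?msum0//.
  apply/seteqP; split => x; first by move=> _; rewrite (thinmx0 x).
  by move=> _; exists 0; rewrite /= ?normr0//; rewrite (thinmx0 x) thinmx0.
have [d d0 [P volP]] := vol_seg v.
have [c2 [c2_ge0 c2_le c2E]] := IH m [seq v *m P | v <- s] (etrans (congr1 (fun k => (k < N)%N) (size_map _ _)) sN).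
pose img (K : set 'rV[R]_m.+1) : set 'rV[R]_m := [set x *m P | x in K].
exists (fun i K => c1 i K + if i is i'.+1 then d * c2 i' (img K) else 0); split.
- move=> i K KK; rewrite addr_ge0 ?c1_ge0//; case: i => // i.
  by rewrite mulr_ge0// c2_ge0//; exact: cconv_mulmx.
- move=> i K L KK LL KL; rewrite lerD ?c1_le//; case: i => // i.
  rewrite ler_wpM2l// c2_le//; [exact: cconv_mulmx|exact: cconv_mulmx|].
  by move=> _ [x Kx <-]; exists x => //; exact: KL.
- move=> K lam KK lam0; rewrite [zono _ (_ :: _)]/= (msumC (seg _)) msumA volP//; last by apply: cconv_msum => //; exact: cconv_zono.
  rewrite c1E// image_msum image_zono c2E//; last exact: cconv_mulmx.
  rewrite -EFinM -EFinD; congr EFin.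
  under [RHS]eq_bigr do rewrite mulrDl.
  rewrite big_split /=; congr (_ + _).
  rewrite [RHS]big_ord_recl /= mul0r add0r mulr_sumr; apply: eq_bigr => i _.
  by rewrite /bump /= add1n exprS -/(img K); ring.
Qed.

End Zonotope.

(** * Approximating the ball by zonotopes *)

Section BallZonotope.
Variable R : realType.

Lemma vol_partition m (T : finType) (idx : 'rV[R]_m -> T) (A : set 'rV[R]_m) :
  (forall f, measurable (A `&` [set x | idx x = f] : set (borel R m))) ->
  vol A = (\sum_f vol (A `&` [set x | idx x = f]))%E.
Proof.
move=> mA.
suff H (s : seq T) : uniq s ->
    measurable (A `&` [set x | idx x \in s] : set (borel R m)) /\
    vol (A `&` [set x | idx x \in s]) = (\sum_(f <- s) vol (A `&` [set x | idx x = f]))%E.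
  have [_ <-] := H (index_enum T) (index_enum_uniq T).
  by congr vol; apply/seteqP; split => x /=; [move=> Ax; rewrite mem_index_enum|case].
elim: s => [_|f s IH] /=.
  rewrite big_nil (_ : _ `&` _ = set0); first by split; [|exact: (measure0 (@vol_measure R m))].
  by apply/seteqP; split => x [].
move=> /andP[fs us]; have [ms volE] := IH us.
have -> : A `&` [set x | idx x \in f :: s] =
    (A `&` [set x | idx x = f]) `|` (A `&` [set x | idx x \in s]).
  rewrite -setIUr; congr (_ `&` _); apply/seteqP; split => x /=; rewrite in_cons.
    by move=> /orP[/eqP|]; [left|right].
  by move=> [->|->]; rewrite ?eqxx ?orbT.
split; first exact: measurableU.
rewrite big_cons -volE; apply: (measureU (@vol_measure R m)) => //.
by apply/seteqP; split => // x [[_ /= xf] [_ /= xs]]; move: fs; rewrite -xf xs.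
Qed.

Lemma mulmx_tr_dotp m (x y : 'rV[R]_m) : x *m y^T = (dotp x y)%:M.
Proof.
apply/matrixP => i j; rewrite !ord1 !mxE eqxx mulr1n.
by apply: eq_bigr => k _; rewrite mxE.
Qed.

(** The reflection in the hyperplane orthogonal to u = x - y exchanges x and y: since |x| = |y|, 2
    <x, u> = <u, u>. *)
Lemma reflection m (x y : 'rV[R]_m) : enorm x = enorm y ->
  exists2 U : 'M[R]_m, U *m U^T = 1%:M & x *m U = y.
Proof.
move=> xy; have [->|xny] := eqVneq x y.
  by exists 1%:M; rewrite ?trmx1 ?mulmx1.
pose u := x - y.
have u0 : 0 < dotp u u.
  by rewrite -enorm_sqr exprn_gt0// enorm_gt0// subr_eq0.
pose c := 2 / dotp u u.
have uuT : u *m u^T = (dotp u u)%:M.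
  exact: mulmx_tr_dotp.
have xuT : x *m u^T = (dotp x u)%:M.
  exact: mulmx_tr_dotp.
pose P := u^T *m u.
have PT : P^T = P by rewrite /P trmx_mul trmxK.
have PP : P *m P = dotp u u *: P.
  by rewrite /P mulmxA -(mulmxA u^T) uuT mul_mx_scalar scalemxAl.
exists (1%:M - c *: P).
  have -> : (1%:M - c *: P)^T = 1%:M - c *: P.
    by apply/matrixP => i j; rewrite -{2}PT !mxE eq_sym.
  rewrite mulmxBl mulmxBr !mul1mx.
  rewrite -scalemxAl mulmxBr mulmx1 -scalemxAr PP scalerA.
  rewrite scalerBr scalerA opprB -addrA -[RHS]addr0; congr (_ + _).
  rewrite (_ : c * (c * dotp u u) = c + c) ?scalerDl.
    by rewrite addrK addNr.
  by rewrite /c; field; rewrite gt_eqF.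
rewrite mulmxBr mulmx1 -scalemxAr /P mulmxA xuT mul_scalar_mx scalerA.
have -> : c * dotp x u = 1.
  rewrite /c mulrAC; apply: (canLR (mulfK _)); first by rewrite gt_eqF.
  have := congr1 (fun t => t ^+ 2) xy; rewrite !enorm_sqr => xy2.
  by rewrite mul1r /u dotpBl !dotpBr (dotpC y x) xy2; ring.
by rewrite scale1r /u opprB addrC subrK.
Qed.

(** A substitute for the sphere: it is invariant under rotations but of positive volume, and its
    vectors have length at least 1, which bounds the sums over its cells from below. *)
Definition annulus m : set 'rV[R]_m := [set x | 1 <= enorm x /\ enorm x <= 2].

Lemma compact_annulus m : compact (@annulus m).
Proof.
apply: (@bounded_enorm_compact _ _ _ 2); last by move=> x [].
have -> : @annulus m = [set x | - enorm x <= - 1] `&` [set x | enorm x <= 2].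
  by apply/seteqP; split => x /=; rewrite lerN2.
apply: closedI; apply: closed_le_continuous; last exact: enorm_continuous.
by move=> x; apply: continuousN; exact: enorm_continuous.
Qed.

Lemma vol_annulus_gt0 m : (0 < vol (@annulus m.+1))%E.
Proof.
(* The cube of side 1/(m+1) with corner e_0: there the first coordinate is at least 1 and the
   coordinates add up to at most 2. *)
pose l (i : 'I_m.+1) : R := if i == 0 then 1 else 0.
apply: (@lt_le_trans _ _ (vol [set x : 'rV[R]_m.+1 | forall i, (l i <= x 0 i <= l i + m.+1%:R^-1)%R])).
  rewrite vol_box; last by move=> i; rewrite lerDl invr_ge0.
  by rewrite lte_fin prodr_gt0// => i _; rewrite addrC addKr invr_gt0.
apply: vol_le; first by apply: closed_borel; apply: closed_box.
  by apply: borel_compact; exact: compact_annulus.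
move=> x H; split.
  apply: le_trans (coord_le_enorm x 0); apply: le_trans (ler_norm _).
  by have /andP[] := H 0.
apply: le_trans (enorm_le_sum _) _.
apply: (@le_trans _ _ (\sum_(i < m.+1) (l i + m.+1%:R^-1))).
  apply: ler_sum => i _; have /andP[x0 x1] := H i; rewrite ger0_norm//.
  by apply: le_trans x0; rewrite /l; case: ifP.
rewrite big_split /= sumr_const card_ord -[_ *+ m.+1]mulr_natl mulfV ?pnatr_eq0//.
rewrite big_ord_recl /= /l eqxx big1 ?addr0//.
Qed.

Lemma annulus_partition m (d : R) : 0 < d -> exists (T : finType) (idx : 'rV[R]_m -> T),
  (forall f, measurable (annulus (m := m) `&` [set x | idx x = f] : set (borel R m))) /\
  forall x y, annulus x -> annulus y -> idx x = idx y -> enorm (x - y) <= d.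
Proof.
(* The cells are grid cubes of side e, of diameter at most m e <= d. Adding 2 makes the coordinates
   of points of the annulus nonnegative, so that truncation yields the grid index, which is at most
   N. *)
move=> d0; pose e := d / m.+1%:R; have e0 : 0 < e by rewrite divr_gt0.
pose N := Num.truncn (4 / e).
pose u (x : 'rV[R]_m) i := (x 0 i + 2) / e.
have uN x i : annulus x -> 0 <= u x i /\ (Num.truncn (u x i) < N.+1)%N.
  move=> [_ x2]; have := le_trans (coord_le_enorm x i) x2; rewrite ler_norml => /andP[x3 x4].
  split; first by apply: divr_ge0; [lra|exact: ltW].
  rewrite ltnS; apply: le_truncn; rewrite ler_pM2r ?invr_gt0//; lra.
pose idx (x : 'rV[R]_m) := [ffun i => inord (Num.truncn (u x i)) : 'I_N.+1].
have idxE x f : annulus x -> (idx x = f <-> forall i, (f i)%:R <= u x i < (f i).+1%:R).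
  move=> Ax; split.
    move=> <- i; rewrite ffunE; have [u0 uN'] := uN x i Ax.
    by rewrite inordK//; exact: truncn_itv.
  move=> H; apply/ffunP => i; rewrite ffunE; have [u0 uN'] := uN x i Ax.
  by apply/val_inj => /=; rewrite inordK//; apply/eqP; rewrite truncn_eq.
exists {ffun 'I_m -> 'I_N.+1}, idx; split.
  move=> f.
  pose B := [set x : 'rV[R]_m | forall i, (f i)%:R <= u x i < (f i).+1%:R].
  have -> : annulus (m := m) `&` [set x | idx x = f] = annulus (m := m) `&` B.
    by apply/seteqP; split => x [Ax] /= H; split => //; exact/idxE.
  apply: measurableI; first by apply: borel_compact; exact: compact_annulus.
  have -> : B = \bigcap_(i in [set` 'I_m]) ([set x : 'rV[R]_m | - u x i <= - (f i)%:R] `&`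
      ~` [set x : 'rV[R]_m | - u x i <= - (f i).+1%:R]).
    apply/seteqP; split => x /= H.
      by move=> i _; have /andP[H1 H2] := H i; split => /=; rewrite lerN2//; apply/negP; rewrite -ltNge.
    have Ii i : [set` 'I_m] i by [].
    by move=> i; have [/=] := H i (Ii i); rewrite !lerN2 => -> /negP; rewrite -ltNge.
  have cu i : continuous (fun x : 'rV[R]_m => - u x i).
    rewrite (_ : (fun x => _) = (fun x : 'rV[R]_m => (x 0 i + 2) * - e^-1)); last first.
      by apply/funext => x; rewrite /u mulrN.
    move=> x.
    apply: (@continuousM _ _ (fun x : 'rV[R]_m => x 0 i + 2) (fun=> - e^-1)); last exact: cst_continuous.
    apply: (@continuousD _ _ _ (fun x : 'rV[R]_m => x 0 i) (fun=> 2)); last exact: cst_continuous.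
    exact: coord_continuous.
  apply: fin_bigcap_measurable => [|i _]; first exact: finite_finset.
  by apply: measurableI; [|apply: measurableC]; apply: closed_borel; exact: closed_le_continuous.
move=> x y Ax Ay xy; apply: le_trans (enorm_le_sum _) _.
apply: (@le_trans _ _ (\sum_(i < m) e)); last first.
  rewrite sumr_const card_ord -[_ *+ m]mulr_natl /e mulrA ler_pdivrMr// mulrC ler_pM2l//.
  by rewrite ler_nat.
apply: ler_sum => i _; rewrite !mxE.
have /(_ i) := (idxE x (idx x) Ax).1 erefl; have /(_ i) := (idxE y (idx x) Ay).1 (esym xy).
rewrite /u => /andP[y1 y2] /andP[x1 x2].
rewrite ler_pdivlMr// in y1; rewrite ler_pdivlMr// in x1.
rewrite ltr_pdivrMr// -[(idx x i).+1%:R]natr1 in y2; rewrite ltr_pdivrMr// -[(idx x i).+1%:R]natr1 in x2.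
rewrite ler_norml.
apply/andP; split; lra.
Qed.

(* Cut the annulus X into cells Q_f of diameter at most d and weight a vector v_f
   of each cell by its volume. The resulting S x is close to the integral over X
   of |<y, x>|, which is invariant under rotations of x. *)
Lemma finite_almost_isotropic m (eps : R) : 0 < eps -> eps <= 1 ->
  exists s : seq 'rV[R]_m, forall x,
    (1 - eps) * enorm x <= \sum_(v <- s) `|dotp v x| /\
    \sum_(v <- s) `|dotp v x| <= (1 + eps) * enorm x.
Proof.
move=> e0 e1; case: m => [|m].
  by exists [::] => x; rewrite (thinmx0 x) enorm0 big_nil !mulr0.
(* With this d, the oscillation 2 d M of S on the unit sphere is at most eps times its value [sg] at
   e_0; see [sg0]. *)
pose d := eps / (4 * m.+1%:R).
have d0 : 0 < d by rewrite divr_gt0// mulr_gt0.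
have [T [idx [mQ dQ]]] := annulus_partition m.+1 d0.
pose X := @annulus m.+1.
pose Q f := X `&` [set x | idx x = f].
pose w f := fine (vol (Q f)).
(* An empty cell gets the default 0, but then also has weight 0. *)
pose v f : 'rV[R]_m.+1 := xget 0 (Q f).
have mX : measurable (X : set (borel R m.+1)) by apply: borel_compact; exact: compact_annulus.
have finX (A : set 'rV[R]_m.+1) : measurable (A : set (borel R m.+1)) -> A `<=` X ->
    vol A \is a fin_num.
  by move=> mA AX; apply: (vol_bounded mA (ler0n _ 2)) => x /AX [].
have vQ f y : Q f y -> enorm (y - v f) <= d.
  move=> Qy; have [Xv /= vf] : Q f (v f) by exact: (@xgetI _ 0 (Q f) y).
  by case: Qy => Xy /= yf; apply: dQ => //; rewrite yf vf.
pose S x := \sum_f w f * `|dotp (v f) x|.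
pose M := fine (vol X).
have w_ge0 f : 0 <= w f by rewrite fine_ge0// vol_ge0.
have M0 : 0 < M.
  by rewrite fine_gt0// vol_annulus_gt0 -ge0_fin_numE ?vol_ge0// finX.
have wE : M = \sum_f w f.
  rewrite /M (@vol_partition _ T idx)// sum_fine// => f _; apply: finX; [exact: mQ|by move=> x []].
have XU U x : U *m U^T = 1%:M -> X (x *m U) <-> X x.
  by move=> UU; rewrite /X /annulus /= enorm_isometry.
have rot U x : U *m U^T = 1%:M -> `|S x - S (x *m U)| <= 2 * d * M * enorm x.
  move=> UU.
  (* [Qr f g] is the part of the cell Q_f that U maps into Q_g; its volume is a
     transport plan between the weights of S x and those of S (x U). *)
  pose Qr f g := Q f `&` [set y | idx (y *m U) = g].
  have mQr f g : measurable (Qr f g : set (borel R m.+1)).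
    have -> : Qr f g = Q f `&` [set y | Q g (y *m U)].
      by apply/seteqP; split => y [[Xy yf] /=]; [move=> yg; split => //; split => //; exact/XU|case].
    by apply: measurableI; [exact: mQ|exact: (@borel_mulmx R _ _ U (Q g) (mQ g))].
  pose r f g := fine (vol (Qr f g)).
  have wr f : w f = \sum_g r f g.
    rewrite /w (@vol_partition _ T (fun y => idx (y *m U)))//; last exact: mQr.
    by rewrite sum_fine// => g _; apply: finX => // y [[]].
  have wr' g : w g = \sum_f r f g.
    have QrE f : [set y | Q g (y *m U)] `&` [set y | idx y = f] = Qr f g.
      by apply/seteqP; split => y; rewrite /Qr /Q /=; have := XU U y UU; tauto.
    have mQr' f : measurable ([set y | Q g (y *m U)] `&` [set y | idx y = f] : set (borel R m.+1)).
      by rewrite QrE.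
    rewrite /w -(vol_ortho (mQ g : measurable (Q g : set (borel R m.+1))) UU).
    rewrite (@vol_partition _ T idx)//.
    rewrite /r sum_fine; first by congr fine; apply: eq_bigr => f _; rewrite QrE.
    by move=> f _; apply: finX => // y [[]].
  have r_ge0 f g : 0 <= r f g by rewrite fine_ge0// vol_ge0.
  have -> : S x - S (x *m U) = \sum_f \sum_g r f g * (`|dotp (v f) x| - `|dotp (v g) (x *m U)|).
    rewrite {1}/S; under eq_bigr do rewrite wr mulr_suml.
    rewrite /S; under [X in _ - X]eq_bigr do rewrite wr' mulr_suml.
    rewrite [X in _ - X]exchange_big /= -sumrB; apply: eq_bigr => f _.
    by rewrite -sumrB; apply: eq_bigr => g _; rewrite mulrBr.
  have -> : 2 * d * M * enorm x = \sum_f \sum_g r f g * (2 * d * enorm x).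
    rewrite (_ : _ * enorm x = M * (2 * d * enorm x)); last by ring.
    rewrite wE mulr_suml; apply: eq_bigr => f _.
    by rewrite wr mulr_suml.
  apply: le_trans (ler_norm_sum _ _ _) _; apply: ler_sum => f _.
  apply: le_trans (ler_norm_sum _ _ _) _; apply: ler_sum => g _.
  rewrite normrM (ger0_norm (r_ge0 f g)).
  have [Q0|/set0P [y [Qy /= yg]]] := eqVneq (Qr f g) set0.
    by rewrite /r Q0 (_ : vol set0 = 0%E) ?mul0r//; exact: (measure0 (@vol_measure R m.+1)).
  apply: ler_wpM2l => //.
  have Qgy : Q g (y *m U) by split => //=; apply/XU => //; case: Qy.
  have H1 : `| `|dotp (v f) x| - `|dotp y x| | <= d * enorm x.
    apply: le_trans (ler_dist_dist _ _) _; rewrite -dotpBl; apply: le_trans (abs_dotp_le _ _) _.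
    by rewrite ler_wpM2r ?enorm_ge0// -enormN opprB; exact: vQ.
  have H2 : `| `|dotp (v g) (x *m U)| - `|dotp y x| | <= d * enorm x.
    rewrite -(dotp_isometry y x UU).
    apply: le_trans (ler_dist_dist _ _) _; rewrite -dotpBl; apply: le_trans (abs_dotp_le _ _) _.
    by rewrite (enorm_isometry _ UU) ler_wpM2r ?enorm_ge0// -enormN opprB; exact: vQ.
  move: H1 H2; rewrite !ler_norml => /andP[? ?] /andP[? ?]; apply/andP; split; lra.
have same x y : enorm x = 1 -> enorm y = 1 -> `|S x - S y| <= 2 * d * M.
  move=> x1 y1; have [U UU <-] := reflection (etrans x1 (esym y1)).
  by have := rot U x UU; rewrite x1 mulr1.
pose sg := S (delta_mx 0 0).
have e1' i : enorm (delta_mx 0 i : 'rV[R]_m.+1) = 1.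
  rewrite /enorm /dotp (bigD1 i)//= big1 => [|k ki]; first by rewrite !mxE !eqxx mulr1 addr0 sqrtr1.
  by rewrite !mxE (negbTE ki) andbF mulr0.
(* Summing S over the unit vectors e_i gives at least sum w_f |v_f| >= M, while each S(e_i) differs
   from [sg] by at most 2 d M. So [sg] cannot be small compared with M. *)
have sgM : M <= m.+1%:R * (sg + 2 * d * M).
  apply: (@le_trans _ _ (\sum_(i < m.+1) S (delta_mx 0 i))).
    rewrite exchange_big /= wE; apply: ler_sum => f _; rewrite -mulr_sumr.
    have [Q0|/set0P [y Qy]] := eqVneq (Q f) set0.
      by rewrite /w Q0 (_ : vol set0 = 0%E) ?mul0r//; exact: (measure0 (@vol_measure R m.+1)).
    rewrite ler_peMr//; apply: (@le_trans _ _ (enorm (v f))).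
      by have [[]] : Q f (v f) by exact: (@xgetI _ 0 (Q f) y).
    apply: le_trans (enorm_le_sum _) _; apply: ler_sum => i _.
    rewrite /dotp (bigD1 i)//= mxE !eqxx mulr1 big1 ?addr0// => k ki.
    by rewrite mxE (negbTE ki) andbF mulr0.
  apply: (@le_trans _ _ (\sum_(i < m.+1) (sg + 2 * d * M))); last by rewrite sumr_const card_ord -[_ *+ m.+1]mulr_natl.
  apply: ler_sum => i _; have := same _ _ (e1' i) (e1' 0); rewrite ler_norml => /andP[_].
  by rewrite lerBlDl.
have m0 : 0 < (m.+1%:R : R) by [].
have dm : d * m.+1%:R = eps / 4 by rewrite /d; field; rewrite gt_eqF.
have sg0 : 2 * d * M <= eps * sg.
  have E1 : m.+1%:R * (sg + 2 * d * M) = m.+1%:R * sg + 2 * (d * m.+1%:R) * M by ring.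
  rewrite E1 dm in sgM.
  have H1 : M * (1 - eps / 2) <= m.+1%:R * sg by lra.
  have H2 : eps * (M * (1 - eps / 2)) <= eps * (m.+1%:R * sg) by rewrite ler_wpM2l// ltW.
  have H3 : 0 <= eps * M * (1 - eps) by rewrite !mulr_ge0 ?subr_ge0// ltW.
  have : 0 <= m.+1%:R * (eps * sg - 2 * d * M).
    have -> : m.+1%:R * (eps * sg - 2 * d * M) = eps * (m.+1%:R * sg) - 2 * (d * m.+1%:R) * M by ring.
    rewrite dm; lra.
  by rewrite pmulr_rge0// subr_ge0.
have sgp : 0 < sg.
  have : 0 < eps * sg by apply: lt_le_trans sg0; rewrite !mulr_gt0.
  by rewrite pmulr_rgt0.
(* Dividing by [sg] normalizes S to be within eps of 1 on the unit sphere; homogeneity does the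
   rest. *)
exists [seq (w f / sg) *: v f | f <- index_enum T] => x.
have -> : \sum_(u <- [seq (w f / sg) *: v f | f <- index_enum T]) `|dotp u x| = S x / sg.
  rewrite big_map /S mulr_suml; apply: eq_bigr => f _.
  by rewrite dotpZl normrM ger0_norm ?divr_ge0// ?(ltW sgp)//; ring.
have [->|x0] := eqVneq x 0.
  rewrite enorm0 !mulr0 /S big1 ?mul0r// => f _.
  by rewrite dotpC dotp0l normr0 mulr0.
have nx := enorm_gt0 x0.
pose y := (enorm x)^-1 *: x.
have y1 : enorm y = 1 by rewrite enormZ ger0_norm ?invr_ge0 ?enorm_ge0// mulVf// gt_eqF.
have -> : S x = enorm x * S y.
  rewrite /S mulr_sumr; apply: eq_bigr => f _; rewrite dotpZr normrM ger0_norm ?invr_ge0 ?enorm_ge0//.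
  by field; rewrite gt_eqF.
have := same y _ y1 (e1' 0); rewrite -/sg ler_norml => /andP[S1 S2].
have T1 : enorm x * ((1 - eps) * sg) <= enorm x * S y by rewrite ler_pM2l//; lra.
have T2 : enorm x * S y <= enorm x * ((1 + eps) * sg) by rewrite ler_pM2l//; lra.
by split; [rewrite ler_pdivlMr//|rewrite ler_pdivrMr//]; lra.
Qed.

Definition cball m (r : R) : set 'rV[R]_m := [set x | enorm x <= r].

Lemma parallel_bodyE m (K : set 'rV[R]_m) lam : 0 <= lam ->
  parallel_body K lam = msum K (cball lam).
Proof.
move=> l0; apply/seteqP; split => x [y Ky [b Bb <-]]; exists y => //.
  exists (lam *: b) => //; rewrite /cball /= enormZ (ger0_norm l0) ler_piMr//.
  exact/eballE.
have [l1|l1] := eqVneq lam 0.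
  have -> : b = 0.
    by apply: enorm_eq0; apply/le_anti; rewrite enorm_ge0 andbT -l1.
  by exists 0; [apply/eballE; rewrite enorm0|rewrite scaler0].
exists (lam^-1 *: b); last by rewrite scalerA mulfV// scale1r.
apply/eballE; rewrite enormZ ger0_norm ?invr_ge0// -ler_pdivlMl ?invr_gt0 ?lt_def ?l1//.
by rewrite invrK mulr1.
Qed.

Lemma zono_dotp_le m (s : seq 'rV[R]_m) lam z x : 0 <= lam -> zono lam s z ->
  dotp z x <= lam * \sum_(v <- s) `|dotp v x|.
Proof.
move=> l0; elim: s z => [|v s IH] z /=.
  by move=> ->; rewrite dotp0l big_nil mulr0.
move=> [_ [t /= t1 <-] [w zw <-]]; rewrite big_cons mulrDr dotpDl lerD ?IH//.
rewrite !dotpZl; apply: le_trans (ler_norm _) _.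
by rewrite !normrM (ger0_norm l0) ler_piMl// mulr_ge0.
Qed.

Lemma zono_dotp_max m (s : seq 'rV[R]_m) lam x :
  exists2 z, zono lam s z & dotp z x = lam * \sum_(v <- s) `|dotp v x|.
Proof.
elim: s => [|v s [z zz zE]] /=.
  by exists 0 => //; rewrite dotp0l big_nil mulr0.
pose t := Num.sg (dotp v x).
exists (t *: (lam *: v) + z).
  exists (t *: (lam *: v)); last by exists z.
  by exists t => //=; rewrite normr_sg; case: (_ == _).
by rewrite dotpDl zE big_cons mulrDr !dotpZl mulrCA -/t /t -normrEsg.
Qed.

(** Testing z against itself gives |z|^2 <= lam c |z|. *)
Lemma zono_sub_cball m (s : seq 'rV[R]_m) (lam c : R) : 0 <= lam -> 0 <= c ->
  (forall x, \sum_(v <- s) `|dotp v x| <= c * enorm x) -> zono lam s `<=` cball (lam * c).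
Proof.
move=> l0 c0 sc z zz; have := zono_dotp_le z l0 zz; rewrite -enorm_sqr.
have [->|z0] := eqVneq z 0.
  by move=> _; rewrite /cball /= enorm0 mulr_ge0.
move=> /le_trans /(_ (ler_wpM2l l0 (sc z))).
by rewrite expr2 mulrA ler_pM2r ?enorm_gt0.
Qed.

(* The support function of the zonotope is lam * sum |<v, x>|; evaluate it at
   y - z, where z is the point of the zonotope nearest to y. *)
Lemma cball_sub_zono m (s : seq 'rV[R]_m) (lam c : R) : 0 <= lam ->
  (forall x, c * enorm x <= \sum_(v <- s) `|dotp v x|) -> cball (lam * c) `<=` zono lam s.
Proof.
move=> l0 sc y yc.
have [cZ vZ] := cconv_zono lam s.
have Z0 : zono lam s !=set0 by have [z zz _] := zono_dotp_max s lam 0; exists z.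
have cf : continuous (fun z : 'rV[R]_m => enorm (z - y)).
  move=> z; apply: (@continuous_comp _ _ _ (fun z : 'rV[R]_m => z - y) (@enorm R m)); last exact: enorm_continuous.
  exact: translate_continuous.
have [z] := @EVT_min_rV R m _ _ Z0 cZ (continuous_subspaceT cf).
rewrite inE => Zz zmin'.
have zmin t : t \in zono lam s -> enorm (y - z) <= enorm (y - t).
  by move=> /zmin'; rewrite -enormN opprB -(enormN (t - y)) opprB.
pose u := y - z.
(* The first-order condition at the nearest point: moving from z towards w by a fraction t does not
   bring it closer to y. *)
have uw w : zono lam s w -> dotp u (w - z) <= 0.
  move=> Zw.
  have H (t : R) : 0 < t -> t <= 1 -> 2 * dotp u (w - z) <= t * dotp (w - z) (w - z).
    move=> t0 t1.
    have := zmin (t *: w + (1 - t) *: z); rewrite inE => /(_ (vZ _ _ _ (ltW t0) t1 Zw Zz)).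
    rewrite -ler_sqr ?nnegrE ?enorm_ge0// !enorm_sqr.
    have -> : y - (t *: w + (1 - t) *: z) = u - t *: (w - z).
      by rewrite /u scalerBl scale1r scalerBr !opprD !opprK; rewrite !addrA; congr (_ + _); rewrite addrAC.
    rewrite -/u; set p := w - z; rewrite (dotpBl u) !(dotpBr u) !dotpZl !dotpZr (dotpC p u) => H.
    have : 0 <= t * (t * dotp p p - 2 * dotp u p) by lra.
    by rewrite pmulr_rge0// subr_ge0.
  rewrite leNgt; apply/negP => d0.
  set q := dotp (w - z) (w - z) in H; have q0 : 0 <= q by exact: dotp_ge0.
  (* For this t one has t q <= <u, w - z>, against 2 <u, w - z> <= t q. *)
  pose t := Num.min 1 (dotp u (w - z) / (q + 1)).
  have t0 : 0 < t by rewrite lt_min ltr01 divr_gt0// ltr_wpDl.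
  have t1 : t <= 1 by rewrite ge_min lexx.
  have := H t t0 t1.
  have : t * (q + 1) <= dotp u (w - z) by rewrite -ler_pdivlMr ?ltr_wpDl// ge_min lexx orbT.
  lra.
have [w Zw wE] := zono_dotp_max s lam u.
have := uw w Zw; rewrite dotpBr (dotpC u w) wE => H.
have H1 : lam * (c * enorm u) <= dotp u z.
  by apply: le_trans (ler_wpM2l l0 (sc u)) _; rewrite -subr_le0.
have H2 : dotp u z = dotp u y - enorm u ^+ 2 by rewrite enorm_sqr /u dotpBr -[dotp _ z]opprK; ring.
have H3 : dotp u y <= enorm u * (lam * c).
  by apply: le_trans (dotp_le _ _) _; rewrite ler_wpM2l ?enorm_ge0.
have u0 : u = 0.
  apply: enorm_eq0; apply/eqP; rewrite -sqrf_eq0 eq_le sqr_ge0 andbT.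
  lra.
by move/eqP: u0; rewrite subr_eq0 => /eqP ->.
Qed.

End BallZonotope.

(** * Quermassintegrals *)

Section Steiner.
Variable R : realType.

(** Inverting the Vandermonde matrix at the nodes 0, ..., m expresses coefficients linearly in
    values. This yields both their uniqueness and their passage to the limit. *)
Lemma interpolation m : exists a : 'M[R]_m.+1, forall (c : nat -> R) (i : 'I_m.+1),
  c i = \sum_(s < m.+1) a i s * (\sum_(l < m.+1) c l * s%:R ^+ l).
Proof.
pose V : 'M[R]_m.+1 := Vandermonde m.+1 (\row_s s%:R).
have uV : V \in unitmx.
  rewrite unitmxE det_Vandermonde unitfE; apply/prodf_neq0 => i _; apply/prodf_neq0 => j ij.
  by rewrite !mxE subr_eq0 eqr_nat gtn_eqF.
exists (invmx V)^T => c i.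
pose cr : 'rV[R]_m.+1 := \row_l c l.
have := congr1 (fun M : 'rV_m.+1 => M 0 i) (mulmxK uV cr); rewrite !mxE => <-.
by apply: eq_bigr => s _; rewrite !mxE mulrC; congr (_ * _); apply: eq_bigr => l _; rewrite !mxE.
Qed.

Lemma poly_coef_unique m (b c : nat -> R) :
  (forall lam, 0 <= lam -> \sum_(i < m.+1) b i * lam ^+ i = \sum_(i < m.+1) c i * lam ^+ i) ->
  forall i, (i <= m)%N -> b i = c i.
Proof.
move=> bc i im; have [a aE] := interpolation m.
have /= -> := aE b (Ordinal (im : (i < m.+1)%N)); have /= -> := aE c (Ordinal (im : (i < m.+1)%N)).
by apply: eq_bigr => s _; rewrite bc.
Qed.

Lemma cvgn_sum I (s : seq I) (u : I -> nat -> R) (l : I -> R) :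
  (forall i, u i n @[n --> \oo] --> l i) ->
  \sum_(i <- s) u i n @[n --> \oo] --> \sum_(i <- s) l i.
Proof.
move=> ul; elim: s => [|i s IH].
  by rewrite big_nil; under eq_fun do rewrite big_nil; exact: cvg_cst.
by rewrite big_cons; under eq_fun do rewrite big_cons; apply: cvgD.
Qed.

Lemma cvgn_expr (u : nat -> R) (l : R) m :
  u n @[n --> \oo] --> l -> u n ^+ m @[n --> \oo] --> l ^+ m.
Proof.
move=> ul; elim: m => [|m IH]; first by rewrite expr0; exact: cvg_cst.
by rewrite exprS; under eq_fun do rewrite exprS; apply: cvgM.
Qed.

Lemma cconv_cball m (r : R) : 0 <= r -> cconv (@cball R m r).
Proof.
move=> r0; have -> : @cball R m r = msum [set 0] (cball r).
  by rewrite msumC msum0.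
rewrite -parallel_bodyE//.
have -> : parallel_body [set 0] r = [set x *m r%:M | x in @eball R m].
  apply/seteqP; split => x; first by move=> [_ -> [b Bb <-]]; exists b => //; rewrite mul_mx_scalar add0r.
  by move=> [b Bb <-]; exists 0 => //; exists b => //; rewrite mul_mx_scalar add0r.
by apply: cconv_mulmx; exact: cconv_eball.
Qed.

Lemma cconv_parallel m (K : set 'rV[R]_m) r : cconv K -> 0 <= r -> cconv (msum K (cball r)).
Proof. by move=> KK r0; apply: cconv_msum => //; exact: cconv_cball. Qed.

(** Nonnegative coefficients turn an error in the radius into a factor. In [steiner_coef] this takes
    the place of continuity of the volume in lam. *)
Lemma poly_scale_le m (c : nat -> R) t lam : (forall i, 0 <= c i) -> 1 <= t -> 0 <= lam ->
  \sum_(i < m.+1) c i * (t * lam) ^+ i <= t ^+ m * \sum_(i < m.+1) c i * lam ^+ i.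
Proof.
move=> c0 t1 l0; rewrite mulr_sumr; apply: ler_sum => i _.
rewrite exprMn mulrCA ler_wpM2r ?mulr_ge0 ?exprn_ge0//.
by rewrite ler_weXn2l// -ltnS.
Qed.

Lemma steiner_coef m : exists c : nat -> set 'rV[R]_m -> R,
  [/\ forall i K, cconv K -> (i <= m)%N -> 0 <= c i K,
      forall i K L, cconv K -> cconv L -> (i <= m)%N -> K `<=` L -> c i K <= c i L &
      forall K (lam : R), cconv K -> 0 <= lam ->
        vol (msum K (cball lam)) = (\sum_(i < m.+1) c i K * lam ^+ i)%:E].
Proof.
(* The offset 2 keeps 1 - eps k positive from k = 0 on. *)
pose eps (k : nat) : R := k.+2%:R^-1.
have eps0 k : 0 < eps k by rewrite invr_gt0.
have eps1 k : eps k < 1 by rewrite invf_lt1// ltr1n.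
have /choice [s sP] : forall k, exists s : seq 'rV[R]_m, forall x,
    (1 - eps k) * enorm x <= \sum_(v <- s) `|dotp v x| /\
    \sum_(v <- s) `|dotp v x| <= (1 + eps k) * enorm x.
  by move=> k; apply: finite_almost_isotropic => //; exact: ltW.
have /choice [c cP] := fun k => vol_zono (s k).
pose phi K (lam : R) := fine (vol (msum K (@cball R m lam))).
pose q k K lam := \sum_(i < m.+1) c k i K * lam ^+ i.
have volE K lam : cconv K -> 0 <= lam -> vol (msum K (cball lam)) = (phi K lam)%:E.
  move=> KK l0; rewrite fineK// vol_compact_fin//; exact: (cconv_parallel KK l0).1.
have volq k K lam : cconv K -> 0 <= lam -> vol (msum K (zono lam (s k))) = (q k K lam)%:E.
  by move=> KK l0; have [_ _ ->] := cP k.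
have mle (A B : set 'rV[R]_m) : cconv A -> cconv B -> A `<=` B -> (vol A <= vol B)%E.
  by move=> AA BB AB; apply: vol_le => //; apply: borel_compact; [exact: AA.1|exact: BB.1].
have q1 k K lam : cconv K -> 0 <= lam -> phi K (lam * (1 - eps k)) <= q k K lam.
  move=> KK l0.
  have l1 : 0 <= lam * (1 - eps k) by rewrite mulr_ge0// subr_ge0 ltW.
  rewrite -lee_fin -volE// -volq//; apply: mle; first exact: cconv_parallel.
    by apply: cconv_msum => //; exact: cconv_zono.
  by apply: msum_subset => //; apply: cball_sub_zono => // x; have [] := sP k x.
have q2 k K lam : cconv K -> 0 <= lam -> q k K lam <= phi K (lam * (1 + eps k)).
  move=> KK l0.
  have l1 : 0 <= 1 + eps k by rewrite addr_ge0// ltW.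
  have l2 : 0 <= lam * (1 + eps k) by rewrite mulr_ge0.
  rewrite -lee_fin -volE// -volq//; apply: mle; last 2 first.
  - exact: cconv_parallel.
  - by apply: msum_subset => //; apply: zono_sub_cball => // x; have [] := sP k x.
  by apply: cconv_msum => //; exact: cconv_zono.
(* [q1] and [q2] are applied at lam / (1 - eps k) and lam / (1 + eps k), so that the volume appears
   at the same lam on both sides; [poly_scale_le] brings q back to lam. *)
have q3 k K lam : cconv K -> 0 <= lam ->
    (1 - eps k) ^+ m * phi K lam <= q k K lam <= (1 + eps k) ^+ m * phi K lam.
  move=> KK l0; have c_ge0 i : 0 <= c k i K by have [+ _ _] := cP k; apply.
  have e1 : 0 < 1 - eps k by rewrite subr_gt0.
  have e2 : 0 < 1 + eps k by rewrite addr_gt0.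
  apply/andP; split.
    rewrite -ler_pdivlMl ?exprn_gt0// -exprVn.
    have l1 : 0 <= (1 - eps k)^-1 * lam by rewrite mulr_ge0// invr_ge0 ltW.
    have := q1 k K ((1 - eps k)^-1 * lam) KK l1.
    rewrite mulrAC mulVf ?gt_eqF// mul1r => /le_trans; apply.
    by apply: (@poly_scale_le m (fun i => c k i K)) => //; rewrite invf_ge1// gerBl ltW.
  have l1 : 0 <= (1 + eps k)^-1 * lam by rewrite mulr_ge0// invr_ge0 ltW.
  apply: (@le_trans _ _ ((1 + eps k) ^+ m * q k K ((1 + eps k)^-1 * lam))).
    rewrite -{1}[lam](mulVKf (lt0r_neq0 e2)) (mulrC _ (_ * _)) mulrC.
    by apply: (@poly_scale_le m (fun i => c k i K)) => //; rewrite lerDl ltW.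
  apply: ler_wpM2l; first by rewrite exprn_ge0// ltW.
  by have := q2 k K _ KK l1; rewrite mulrAC mulVf ?gt_eqF// mul1r.
have eps_cvg : eps k @[k --> \oo] --> 0.
  apply: (squeeze_cvgr _ (cvg_cst 0) (@cvg_harmonic R)).
  by apply: nearW => k; rewrite ltW//= lef_pV2 ?posrE// ler_nat.
have qcvg K lam : cconv K -> 0 <= lam -> q k K lam @[k --> \oo] --> phi K lam.
  move=> KK l0.
  apply: (squeeze_cvgr _ (f := fun k => (1 - eps k) ^+ m * phi K lam)
     (h := fun k => (1 + eps k) ^+ m * phi K lam)).
  - by apply: nearW => k; exact: q3.
  - rewrite -[X in _ --> X]mul1r; apply: cvgM; last exact: cvg_cst.
    rewrite -[X in _ --> X](expr1n _ m); apply: cvgn_expr.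
    by rewrite -[X in _ --> X]subr0; apply: cvgB => //; exact: cvg_cst.
  - rewrite -[X in _ --> X]mul1r; apply: cvgM; last exact: cvg_cst.
    rewrite -[X in _ --> X](expr1n _ m); apply: cvgn_expr.
    by rewrite -[X in _ --> X]addr0; apply: cvgD => //; exact: cvg_cst.
(* Convergence of a polynomial at 0, ..., m entails that of its coefficients. *)
have [a aE] := interpolation m.
pose C i K := \sum_(t < m.+1) a (inord i) t * phi K t%:R.
have Ccvg K i : cconv K -> (i <= m)%N -> c k i K @[k --> \oo] --> C i K.
  move=> KK im.
  have -> : (fun k => c k i K) = (fun k => \sum_(t < m.+1) a (inord i) t * q k K t%:R).
    by apply/funext => k; have := aE (fun i => c k i K) (inord i); rewrite inordK.
  apply: (@cvgn_sum _ _ (fun t k => a (inord i) t * q k K t%:R) (fun t => a (inord i) t * phi K t%:R)) => t.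
  by apply: cvgM; [exact: cvg_cst|exact: qcvg].
exists C; split.
- move=> i K KK im; apply: (ler_cvg_to (cvg_cst 0) (Ccvg K i KK im)).
  by apply: nearW => k; have [+ _ _] := cP k; apply.
- move=> i K L KK LL im KL; apply: (ler_cvg_to (Ccvg K i KK im) (Ccvg L i LL im)).
  by apply: nearW => k; have [_ + _] := cP k; apply.
- move=> K lam KK l0; rewrite volE//; congr EFin.
  apply: (@cvg_unique _ _ _ _ _ _ (qcvg K lam KK l0)); first exact: norm_hausdorff.
  apply: (@cvgn_sum _ _ (fun (i : 'I_m.+1) k => c k i K * lam ^+ i) (fun i : 'I_m.+1 => C i K * lam ^+ i)) => i.
  by apply: cvgM; [apply: Ccvg => //; rewrite -ltnS|exact: cvg_cst].
Qed.

(** Coefficients being unique, the choice in [quermass] has a single candidate; any polynomial that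
    gives the volumes thus computes it. *)
Lemma quermass_unique m (K : set 'rV[R]_m) (b : nat -> R) j : (j <= m)%N ->
  (forall lam, 0 <= lam -> vol (msum K (cball lam)) = (\sum_(i < m.+1) b i * lam ^+ i)%:E) ->
  quermass j K = b j / 'C(m, j)%:R.
Proof.
move=> jm bE.
have bin0 i : (i <= m)%N -> ('C(m, i)%:R : R) != 0 by move=> im; rewrite pnatr_eq0 -lt0n bin_gt0.
have sb : steiner K (fun i => b i / 'C(m, i)%:R).
  move=> lam l0; rewrite parallel_bodyE// bE//; congr EFin; apply: eq_bigr => i _.
  by rewrite mulrCA mulfV ?mulr1// bin0// -ltnS.
rewrite /quermass; apply: xget_subset1; first by exists (fun i => b i / 'C(m, i)%:R).
have H W : steiner K W -> 'C(m, j)%:R * W j = b j.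
  move=> sW; apply: (@poly_coef_unique m (fun i => 'C(m, i)%:R * W i) b) => // lam l0.
  by have := sW lam l0; rewrite parallel_bodyE// bE// => -[].
move=> _ _ [W /H WE ->] [W' /H W'E ->].
by apply: (mulfI (bin0 j jm)); rewrite WE W'E.
Qed.

Lemma quermass_steiner m (K : set 'rV[R]_m) (lam : R) : cconv K -> 0 <= lam ->
  vol (msum K (cball lam)) = (\sum_(i < m.+1) ('C(m, i)%:R * quermass i K) * lam ^+ i)%:E.
Proof.
move=> KK l0; have [c [_ _ cE]] := steiner_coef m.
rewrite cE//; congr EFin; apply: eq_bigr => i _; congr (_ * _).
have im : (i <= m)%N by rewrite -ltnS.
rewrite (quermass_unique im (b := fun i => c i K)); last by move=> *; exact: cE.
by rewrite mulrCA mulfV ?mulr1// pnatr_eq0 -lt0n bin_gt0.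
Qed.

Lemma quermass_ge0 m (K : set 'rV[R]_m) j : cconv K -> (j <= m)%N -> 0 <= quermass j K.
Proof.
move=> KK jm; have [c [c0 _ cE]] := steiner_coef m.
rewrite (quermass_unique (b := fun i => c i K))//; last by move=> *; exact: cE.
by rewrite divr_ge0// c0.
Qed.

Lemma quermass_le m (K L : set 'rV[R]_m) j : cconv K -> cconv L -> (j <= m)%N ->
  K `<=` L -> quermass j K <= quermass j L.
Proof.
move=> KK LL jm KL; have [c [_ cle cE]] := steiner_coef m.
rewrite (quermass_unique (b := fun i => c i K))//; last by move=> *; exact: cE.
rewrite (quermass_unique (b := fun i => c i L))//; last by move=> *; exact: cE.
by rewrite ler_wpM2r ?invr_ge0// cle.
Qed.

Lemma quermass_ortho m (K : set 'rV[R]_m) (U : 'M[R]_m) j : cconv K -> (j <= m)%N ->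
  U *m U^T = 1%:M -> quermass j [set x | K (x *m U)] = quermass j K.
Proof.
move=> KK jm UU.
rewrite (quermass_unique (b := fun i => 'C(m, i)%:R * quermass i K))//.
  by rewrite mulrC mulKf// pnatr_eq0 -lt0n bin_gt0.
move=> lam l0; rewrite -quermass_steiner//.
rewrite -(vol_ortho (borel_compact (cconv_parallel KK l0).1) UU).
congr vol; apply/seteqP; split => x /=.
  move=> [k Kk [b bl <-]]; exists (k *m U) => //; exists (b *m U); last by rewrite mulmxDl.
  by rewrite /cball /= enorm_isometry.
have UT : U^T *m U^T^T = 1%:M by rewrite trmxK; exact: ortho_tr.
move=> [k Kk [b bl xE]]; exists (k *m U^T) => /=; first by rewrite -mulmxA ortho_tr// mulmx1.
exists (b *m U^T); first by rewrite /cball /= enorm_isometry.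
by rewrite -mulmxDl xE -mulmxA UU mulmx1.
Qed.

(** Compare coefficients in |tK + lam B| = t^m |K + (lam/t) B|. *)
Lemma quermass_scale m (K : set 'rV[R]_m) (t : R) j : cconv K -> (j <= m)%N -> 0 < t ->
  quermass j [set t *: x | x in K] = t ^+ (m - j) * quermass j K.
Proof.
move=> KK jm t0.
rewrite (quermass_unique (b := fun i => 'C(m, i)%:R * (t ^+ (m - i) * quermass i K)))//.
  by rewrite mulrC mulKf// pnatr_eq0 -lt0n bin_gt0.
move=> lam l0; have l1 : 0 <= lam / t by rewrite divr_ge0// ltW.
have tK : cconv [set t *: x | x in K].
  have -> : [set t *: x | x in K] = [set x *m t%:M | x in K].
    by apply/seteqP; split => _ [x Kx <-]; exists x; rewrite ?mul_mx_scalar.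
  exact: cconv_mulmx.
rewrite (vol_scale (borel_compact (cconv_parallel tK l0).1) t0).
have -> : [set x | msum [set t *: x0 | x0 in K] (cball lam) (t *: x)] = msum K (cball (lam / t)).
  apply/seteqP; split => x /=.
    move=> [_ [k Kk <-] [b bl xE]]; exists k => //; exists (t^-1 *: b).
      by rewrite /cball /= enormZ ger0_norm ?invr_ge0 ?(ltW t0)// mulrC ler_wpM2r// invr_ge0 ltW.
    by apply: (@scalerI _ _ t); rewrite ?gt_eqF// scalerDr scalerA mulfV ?gt_eqF// scale1r.
  move=> [k Kk [b bl <-]]; exists (t *: k); first by exists k.
  exists (t *: b); last by rewrite scalerDr.
  by rewrite /cball /= enormZ (ger0_norm (ltW t0)) -ler_pdivlMl// mulrC.
rewrite quermass_steiner// -EFinM; congr EFin; rewrite mulr_sumr; apply: eq_bigr => i _.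
have im : (i <= m)%N by rewrite -ltnS.
rewrite -{1}(subnK im) exprD expr_div_n; field.
by rewrite expf_neq0// gt_eqF.
Qed.

End Steiner.

(** * Quermassintegrals and boxes *)

Section Bounds.
Variable R : realType.

(** For orthonormal U, the box with half-sides r_i along the rows of U. *)
Definition slab n (U : 'M[R]_n) (r : nat -> R) : set 'rV[R]_n :=
  [set x | forall i : 'I_n, `|dotp x (row i U)| <= r i].

Lemma dotp_row m n (U : 'M[R]_(m, n)) x i : dotp x (row i U) = (x *m U^T) 0 i.
Proof. by rewrite mxE; apply: eq_bigr => k _; rewrite !mxE. Qed.

Lemma dotp_rows m n (U : 'M[R]_(m, n)) i k : U *m U^T = 1%:M ->
  dotp (row i U) (row k U) = (i == k)%:R.
Proof. by move=> UU; rewrite dotp_row -row_mul UU !mxE. Qed.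

Lemma ortho_expand n (U : 'M[R]_n) x : U *m U^T = 1%:M ->
  x = \sum_(i < n) dotp x (row i U) *: row i U.
Proof.
move=> UU; rewrite -{1}[x]mulmx1 -(ortho_tr UU) mulmxA mulmx_sum_row.
by apply: eq_bigr => i _; rewrite dotp_row.
Qed.

Lemma vol_slab n (U : 'M[R]_n) (r : nat -> R) : U *m U^T = 1%:M -> (forall i, 0 <= r i) ->
  vol (slab U r) = (\prod_(0 <= i < n) (2 * r i))%:E.
Proof.
move=> UU r0; have UT : U^T *m U^T^T = 1%:M by rewrite trmxK; exact: ortho_tr.
have -> : slab U r = [set x | [set y : 'rV[R]_n | forall i : 'I_n, - r i <= y 0 i <= r i] (x *m U^T)].
  by apply/seteqP; split => x H i; have := H i; rewrite dotp_row ler_norml.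
rewrite vol_ortho//; last by apply: closed_borel; exact: closed_box.
rewrite (@vol_box R n (fun i => - r i) (fun i => r i)); last by move=> i; rewrite (@le_trans _ _ 0)// oppr_le0.
by rewrite big_mkord; congr EFin; apply: eq_bigr => i _; rewrite opprK mulr2n mulrDl !mul1r.
Qed.

Lemma cconv_slab n (U : 'M[R]_n) (r : nat -> R) : U *m U^T = 1%:M -> cconv (slab U r).
Proof.
move=> UU; split.
  apply: (@bounded_enorm_compact _ _ _ (\sum_(i < n) r i)).
    have -> : slab U r = \bigcap_(i in [set: 'I_n]) [set x | `|dotp x (row i U)| <= r i].
      by apply/seteqP; split => x H i; [move=> _; exact: H|exact: (H i I)].
    apply: closed_bigI => i _; apply: closed_le_continuous => x.
    apply: (@continuous_comp _ _ _ (fun x : 'rV[R]_n => dotp x (row i U)) (fun t : R => `|t|)).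
      exact: dotp_continuous.
    exact: norm_continuous.
  move=> x H; rewrite {1}(ortho_expand x UU); apply: le_trans (enorm_sum _ _) _.
  apply: ler_sum => i _; rewrite enormZ /enorm dotp_rows// eqxx sqrtr1 mulr1; exact: H.
move=> x y t t0 t1 Hx Hy i; rewrite dotpDl !dotpZl; have t1' : 0 <= 1 - t by rewrite subr_ge0.
apply: le_trans (ler_normD _ _) _; rewrite !normrM (ger0_norm t0) (ger0_norm t1').
have : t * `|dotp x (row i U)| <= t * r i by rewrite ler_wpM2l.
have : (1 - t) * `|dotp y (row i U)| <= (1 - t) * r i by rewrite ler_wpM2l.
lra.
Qed.

Lemma slab_msum_cball n (U : 'M[R]_n) (r : nat -> R) lam : U *m U^T = 1%:M ->
  msum (slab U r) (cball lam) `<=` slab U (fun i => r i + lam).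
Proof.
move=> UU _ [x Hx [b bl <-]] i; rewrite dotpDl; apply: le_trans (ler_normD _ _) _.
apply: lerD; first exact: (Hx i).
apply: le_trans (abs_dotp_le _ _) _.
by rewrite {2}/enorm dotp_rows// eqxx sqrtr1 mulr1.
Qed.

Lemma cconv_avg n (L : set 'rV[R]_n) N (y : 'I_N.+1 -> 'rV[R]_n) : cconv L ->
  (forall i, L (y i)) -> L (N.+1%:R^-1 *: \sum_i y i).
Proof.
move=> [_ vL]; elim: N y => [|N IH] y Ly; first by rewrite big_ord1 invr1 scale1r.
rewrite big_ord_recl scalerDr.
have := vL (y 0) _ (N.+2%:R^-1) _ _ (Ly 0) (IH (fun i => y (lift 0 i)) (fun i => Ly _)).
rewrite invr_ge0 ler0n invf_le1// ler1n => /(_ erefl erefl); congr (L (_ + _)).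
rewrite scalerA; congr (_ *: _).
have e : (N.+2%:R : R) = N.+1%:R + 1 by rewrite natr1.
have q0 : 0 < (N.+1%:R : R) by [].
rewrite e; clear e; move: (N.+1%:R : R) q0 => q q0.
by field; rewrite !gt_eqF// addr_gt0.
Qed.

Lemma quermass_upper n j (K : set 'rV[R]_n) (U : 'M[R]_n) (a : nat -> R) : (j < n)%N ->
  cconv K -> U *m U^T = 1%:M -> (forall i, 0 < a i) ->
  (forall i k, (i <= k < n)%N -> a k <= a i) ->
  K `<=` slab U (fun i => 2 ^+ n * a i) ->
  quermass j K <= (2 * (2 ^+ n + 1)) ^+ n * \prod_(0 <= i < n - j) a i.
Proof.
move=> jn KK UU a0 adec Ksub; set D := 2 * (2 ^+ n + 1).
have D0 : 0 < D by rewrite mulr_gt0// addr_gt0// exprn_gt0.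
pose lam := a (n - j).-1.
have nj : (0 < n - j)%N by rewrite subn_gt0.
have l0 : 0 < lam by exact: a0.
(* The j-th term of the Steiner polynomial at lam = a_(n-j-1). *)
have H1 : 'C(n, j)%:R * quermass j K * lam ^+ j <= \prod_(0 <= i < n) (2 * (2 ^+ n * a i + lam)).
  rewrite -lee_fin -(vol_slab UU); last first.
    by move=> i; rewrite addr_ge0 ?mulr_ge0 ?exprn_ge0// ltW.
  apply: (@le_trans _ _ (vol (msum K (cball lam)))).
    rewrite quermass_steiner ?(ltW l0)// lee_fin (bigD1 (Ordinal (ltnW jn : (j < n.+1)%N)))//=.
    rewrite lerDl; apply: sumr_ge0 => i _; rewrite mulr_ge0 ?exprn_ge0 ?(ltW l0)// mulr_ge0//.
    by apply: quermass_ge0 => //; rewrite -ltnS.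
  apply: vol_le; [apply: borel_compact|apply: borel_compact|].
  - by have [] := cconv_parallel KK (ltW l0).
  - by have [] := cconv_slab (fun i => 2 ^+ n * a i + lam) UU.
  - apply: subset_trans (slab_msum_cball (r := fun i => 2 ^+ n * a i) (lam := lam) UU).
    exact: msum_subset.
(* By monotonicity lam <= a_i for i < n - j and a_i <= lam from there on; so each factor is at most
   D a_i, respectively D lam, and lam^j cancels against the left side of [H1]. *)
have H2 : \prod_(0 <= i < n) (2 * (2 ^+ n * a i + lam)) <= D ^+ n * (\prod_(0 <= i < n - j) a i) * lam ^+ j.
  rewrite (big_cat_nat (n := n - j))//=; last exact: leq_subr.
  have -> : D ^+ n * \prod_(0 <= i < n - j) a i * lam ^+ j =
     (D ^+ (n - j) * \prod_(0 <= i < n - j) a i) * (D ^+ j * lam ^+ j).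
    by rewrite -{1}(subnK (ltnW jn)) exprD; ring.
  have s0 i : 0 <= 2 * (2 ^+ n * a i + lam).
    by rewrite mulr_ge0// addr_ge0 ?(ltW l0)// mulr_ge0 ?exprn_ge0// ltW.
  apply: ler_pM; [exact: prodr_ge0|exact: prodr_ge0| |].
    have -> : D ^+ (n - j) = \prod_(0 <= i < n - j) D by rewrite prodr_const_nat subn0.
    rewrite -big_split /= !big_nat; apply: ler_prod => i /andP[_ ij]; rewrite s0 /=.
    have : lam <= a i.
      by apply: adec; apply/andP; split; [rewrite -ltnS prednK|rewrite prednK// leq_subr].
    have := exprn_ge0 n (ler0n R 2); have := a0 i; rewrite /D; nra.
  rewrite -exprMn.
  have -> : (D * lam) ^+ j = \prod_(n - j <= i < n) (D * lam).
    by rewrite prodr_const_nat subKn// ltnW.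
  rewrite !big_nat; apply: ler_prod => i /andP[ji ik]; rewrite s0 /=.
  have : a i <= lam by apply: adec; rewrite ik andbT (leq_trans (leq_pred _)).
  have := exprn_ge0 n (ler0n R 2); have := a0 i; rewrite /D; nra.
have H3 := le_trans H1 H2; rewrite ler_pM2r ?exprn_gt0// in H3.
apply: le_trans H3; rewrite ler_peMl ?quermass_ge0 1?ltnW//.
by rewrite ler1n bin_gt0 ltnW.
Qed.

(** The upper bound forces c_i = 0 for i < j, as c_i lam^i <= E lam^j. Dividing the lower bound by
    lam^j and letting lam tend to 0 then leaves c_j alone. *)
Lemma lowest_coef_ge m j (c : nat -> R) (D E : R) : (j <= m)%N -> (forall i, (i <= m)%N -> 0 <= c i) ->
  (forall lam, 0 < lam -> lam <= 1 ->
    D * lam ^+ j <= \sum_(i < m.+1) c i * lam ^+ i <= E * lam ^+ j) -> D <= c j.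
Proof.
move=> jm c0 H.
have E0 : 0 <= E.
  have /andP[_] := H 1 ltr01 (lexx 1); rewrite expr1n mulr1; apply: le_trans.
  by apply: sumr_ge0 => i _; rewrite expr1n mulr1 c0// -ltnS.
(* The limit at 0: for x > 0 the lam chosen below would give x <= x / 2. *)
have small (x B : R) : 0 <= B -> (forall lam : R, 0 < lam -> lam <= 1 -> x <= lam * B) -> x <= 0.
  move=> B0 xB; rewrite leNgt; apply/negP => x0.
  pose lam := Num.min 1 (x / (2 * (B + 1))).
  have B1 : 0 < 2 * (B + 1) by rewrite mulr_gt0// ltr_wpDl.
  have l0 : 0 < lam by rewrite lt_min ltr01 divr_gt0.
  have l1 : lam <= 1 by rewrite ge_min lexx.
  have := xB lam l0 l1.
  have : lam * (2 * (B + 1)) <= x by rewrite -ler_pdivlMr// ge_min lexx orbT.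
  nra.
have cz i : (i < j)%N -> c i = 0.
  move=> ij; have im : (i < m.+1)%N by rewrite ltnS (leq_trans (ltnW ij)).
  apply/le_anti; rewrite c0 ?andbT//; apply: (small _ _ E0) => lam l0 l1.
  have /andP[_ H2] := H lam l0 l1.
  have : c i * lam ^+ i <= E * lam ^+ j.
    apply: le_trans H2; rewrite (bigD1 (Ordinal im))//= lerDl.
    by apply: sumr_ge0 => k _; rewrite mulr_ge0 ?exprn_ge0 ?(ltW l0)// c0// -ltnS.
  rewrite -(subnK ij) addnS -addSn exprD mulrA ler_pM2r ?exprn_gt0// => /le_trans; apply.
  by rewrite exprS mulrCA ler_wpM2l ?(ltW l0)// ler_piMr// exprn_ile1// ltW.
rewrite -subr_le0.
apply: (small _ (\sum_(i < m.+1) c i)) => [|lam l0 l1].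
  by apply: sumr_ge0 => k _; rewrite c0// -ltnS.
have /andP[H1 _] := H lam l0 l1.
have jm' : (j < m.+1)%N by rewrite ltnS.
rewrite lerBlDl -(@ler_pM2r _ (lam ^+ j)) ?exprn_gt0//; apply: le_trans H1 _.
rewrite (bigD1 (Ordinal jm'))//= mulrDl lerD2l mulr_sumr mulr_suml.
rewrite [leRHS](bigD1 (Ordinal jm'))//= -[leLHS]add0r; apply: lerD.
  by rewrite !mulr_ge0 ?exprn_ge0 ?(ltW l0)// c0.
apply: ler_sum => i ij; have [ilt|ige] := ltnP i j.
  by rewrite cz// mul0r mulr0 mul0r.
have {ige ij}ji : (j < i)%N by rewrite ltn_neqAle ige andbT eq_sym; move: ij; rewrite -val_eqE.
have im : (i <= m)%N by rewrite -ltnS.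
have -> : lam * c i * lam ^+ j = c i * lam ^+ j.+1 by rewrite exprS; ring.
apply: ler_wpM2l; first exact: c0.
by rewrite -(subnK ji) exprD ler_piMl ?exprn_ge0 ?(ltW l0)// exprn_ile1// ltW.
Qed.

Lemma sym_seg n (L : set 'rV[R]_n) y (t : R) : cconv L -> (forall x, L x -> L (- x)) ->
  L y -> `|t| <= 1 -> L (t *: y).
Proof.
move=> [_ vL] Ls Ly; rewrite ler_norml => /andP[t0 t1].
have -> : t *: y = ((1 + t) / 2) *: y + (1 - (1 + t) / 2) *: (- y).
  by rewrite scalerN -scalerBl; congr (_ *: _); field.
by apply: vL => //; [lra|lra|exact: Ls].
Qed.

Lemma ortho_coord n (U : 'M[R]_n) (c : 'I_n -> R) k : U *m U^T = 1%:M ->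
  dotp (\sum_i c i *: row i U) (row k U) = c k.
Proof.
move=> UU; rewrite dotp_suml (bigD1 k)//= big1 => [|i ik]; rewrite dotpZl dotp_rows//.
  by rewrite eqxx mulr1 addr0.
by rewrite (negbTE ik) mulr0.
Qed.

(* L contains the (m-j)-dimensional box Q with half-sides a_i / m, whose Steiner
   polynomial is of order lam^j at 0. *)
Lemma quermass_lower m j (L : set 'rV[R]_m) (U : 'M[R]_m) (a : nat -> R) : (j < m)%N ->
  cconv L -> (forall x, L x -> L (- x)) -> U *m U^T = 1%:M -> (forall i, 0 < a i) ->
  (forall i : 'I_m, L (a i *: row i U)) ->
  (2 / m%:R) ^+ m / 'C(m, j)%:R * \prod_(0 <= i < m - j) a i <= quermass j L.
Proof.
move=> jm LL Lsym UU a0 La; have m0 : 0 < (m%:R : R) by rewrite ltr0n (leq_trans _ jm).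
have mj : (m - j <= m)%N by exact: leq_subr.
(* A point of Q is the average of the m vectors m <x, u_i> u_i, each of which lies between -a_i u_i
   and a_i u_i; hence the division by m. *)
pose rho (i : nat) : R := if (i < m - j)%N then a i / m%:R else 0.
pose Q := slab U rho.
have QQ : cconv Q by exact: cconv_slab.
have rho0 i : 0 <= rho i by rewrite /rho; case: ifP => // _; rewrite divr_ge0 ?ltW.
have QL : Q `<=` L.
  case: m => [//|m] in j L U jm LL Lsym UU La m0 mj rho Q QQ rho0 *.
  move=> x Qx; have -> : x = m.+1%:R^-1 *: \sum_i (m.+1%:R * dotp x (row i U)) *: row i U.
    rewrite {1}(ortho_expand x UU) scaler_sumr; apply: eq_bigr => i _.
    by rewrite scalerA mulKf// gt_eqF.
  apply: cconv_avg => // i.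
  have -> : (m.+1%:R * dotp x (row i U)) *: row i U =
      (m.+1%:R * dotp x (row i U) / a i) *: (a i *: row i U).
    by rewrite scalerA divfK// gt_eqF.
  apply: sym_seg => //; rewrite normrM normfV (gtr0_norm (a0 i)) ler_pdivrMr// mul1r.
  rewrite normrM gtr0_norm// mulrC -ler_pdivlMr//; apply: le_trans (Qx i) _.
  by rewrite /rho; case: ifP => // _; rewrite divr_ge0// ltW.
apply: le_trans (quermass_le QQ LL (ltnW jm) QL).
have bin0 : 0 < ('C(m, j)%:R : R) by rewrite ltr0n bin_gt0 ltnW.
rewrite mulrAC ler_pdivrMr// [leRHS]mulrC.
(* A box inside Q + lam B: the part of x along the last j rows has coordinates at most lam / m,
   hence length at most lam. Its volume gives the lower bound of order lam^j. *)
pose sig lam (i : nat) : R := if (i < m - j)%N then a i / m%:R else lam / m%:R.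
have rlow lam : 0 <= lam -> slab U (sig lam) `<=` msum Q (cball lam).
  move=> l0 x Hx.
  exists (\sum_(i < m) (if (i < m - j)%N then dotp x (row i U) else 0) *: row i U).
    move=> k; rewrite ortho_coord// /rho; case: ifP => [kj|_]; last by rewrite normr0.
    by have := Hx k; rewrite /sig kj.
  exists (\sum_(i < m) (if (i < m - j)%N then 0 else dotp x (row i U)) *: row i U).
    rewrite /cball /=; apply: le_trans (enorm_sum _ _) _.
    apply: (@le_trans _ _ (\sum_(i < m) lam / m%:R)); last first.
      by rewrite sumr_const card_ord -[_ *+ m]mulr_natr divfK// gt_eqF.
    apply: ler_sum => i _; rewrite enormZ /enorm dotp_rows// eqxx sqrtr1 mulr1.
    case: ifP => [_|ij]; first by rewrite normr0 divr_ge0// ltW.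
    by have := Hx i; rewrite /sig ij.
  rewrite -big_split /= [RHS](ortho_expand x UU); apply: eq_bigr => i _.
  by rewrite -scalerDl; congr (_ *: _); case: ifP; rewrite ?addr0 ?add0r.
(* The upper constant comes from the enclosing box with half-sides rho_i + lam, where lam <= 1 in
   the first m - j directions. *)
apply: (@lowest_coef_ge m j (fun i => 'C(m, i)%:R * quermass i Q) _
   (\prod_(0 <= i < m - j) (2 * (a i / m%:R + 1)) * 2 ^+ j) (ltnW jm)) => [i im|lam l0 l1].
  by rewrite mulr_ge0// quermass_ge0.
have sig0 i : 0 <= sig lam i by rewrite /sig; case: ifP => _; rewrite divr_ge0// ltW.
have rl0 i : 0 <= rho i + lam by rewrite addr_ge0// ltW.
have QB := cconv_parallel QQ (ltW l0).
rewrite -!lee_fin -quermass_steiner ?(ltW l0)//; apply/andP; split.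
  apply: (@le_trans _ _ (vol (slab U (sig lam)))).
    rewrite vol_slab// lee_fin le_eqVlt; apply/orP; left; apply/eqP.
    rewrite [RHS](big_cat_nat (n := m - j))//=.
    have -> : \prod_(0 <= i < m - j) (2 * sig lam i) = (2 / m%:R) ^+ (m - j) * \prod_(0 <= i < m - j) a i.
      have -> : (2 / m%:R : R) ^+ (m - j) = \prod_(0 <= i < m - j) (2 / m%:R).
        by rewrite prodr_const_nat subn0.
      rewrite -big_split /= !big_nat.
      by apply: eq_bigr => i /andP[_ ij]; rewrite /sig ij; ring.
    have -> : \prod_(m - j <= i < m) (2 * sig lam i) = (2 / m%:R * lam) ^+ j.
      have -> : (2 / m%:R * lam) ^+ j = \prod_(m - j <= i < m) (2 / m%:R * lam).
        by rewrite prodr_const_nat subKn// ltnW.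
      rewrite !big_nat; apply: eq_bigr => i /andP[ij _]; rewrite /sig ltnNge ij /=; ring.
    rewrite [(2 / m%:R * lam) ^+ j]exprMn.
    have -> : (2 / m%:R : R) ^+ m = (2 / m%:R) ^+ (m - j) * (2 / m%:R) ^+ j by rewrite -exprD subnK// ltnW.
    by ring.
  apply: vol_le; [apply: borel_compact|apply: borel_compact|exact: rlow (ltW l0)].
    by have [] := cconv_slab (sig lam) UU.
  by have [] := QB.
apply: (@le_trans _ _ (vol (slab U (fun i => rho i + lam)))).
  apply: vol_le; [apply: borel_compact|apply: borel_compact|exact: slab_msum_cball].
    by have [] := QB.
  by have [] := cconv_slab (fun i => rho i + lam) UU.
rewrite vol_slab// lee_fin (big_cat_nat (n := m - j))//= -mulrA.
have s0 i : 0 <= 2 * (rho i + lam) by rewrite mulr_ge0.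
apply: ler_pM; [exact: prodr_ge0|exact: prodr_ge0| |].
  rewrite !big_nat; apply: ler_prod => i /andP[_ ij]; rewrite s0 /= /rho ij.
  by rewrite ler_wpM2l// lerD2l.
have -> : 2 ^+ j * lam ^+ j = \prod_(m - j <= i < m) (2 * lam).
  by rewrite prodr_const_nat subKn ?exprMn// ltnW.
rewrite !big_nat; apply: ler_prod => i /andP[ij _]; rewrite s0 /= /rho ltnNge ij /= add0r.
exact: lexx.
Qed.

End Bounds.

(** * The greedy frame *)

Section Frames.
Variable R : realType.

Lemma convex_body_cconv n (K : set 'rV[R]_n) : convex_body K -> cconv K.
Proof.
move=> [cK vK _]; split => // x y t t0 t1 Kx Ky.
have t01 : Itv.spec (@Itv.num_sem R) (Itv.Real `[0%Z, 1%Z]) t.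
  by rewrite /= /Itv.num_sem /= num_real in_itv/= t0 t1.
by have := vK x y (Itv.Def t01); rewrite !inE => /(_ Kx Ky).
Qed.

(** If K contains a ball around x0, then y is the midpoint of x0 + y and -(x0 - y), both in K by
    symmetry. *)
Lemma convex_body_ball n (K : set 'rV[R]_n) : convex_body K -> centrally_symmetric K ->
  exists2 rho : R, 0 < rho & cball rho `<=` K.
Proof.
move=> KK Ks; have [_ vK] := convex_body_cconv KK.
have [_ _ [x0 /nbhs_ballP [e /= e0 eK]]] := KK.
exists (e / 2); first by rewrite divr_gt0.
move=> y ye.
have near z : enorm z <= e / 2 -> K (x0 + z).
  move=> ze; apply: eK; rewrite -ball_normE /= opprD addNKr normrN.
  apply: (@le_lt_trans _ _ (enorm z)); last by apply: le_lt_trans ze _; lra.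
  rewrite [leLHS]/Num.norm /= mx_normrE; apply/bigmax_leP; split => /=; first exact: enorm_ge0.
  by move=> [i j] _ /=; rewrite ord1; exact: coord_le_enorm.
have H1 := near y ye.
have H2 : K (- (x0 - y)) by apply: Ks; apply: near; rewrite enormN.
have := vK _ _ (1 / 2) _ _ H1 H2.
have -> : (1 / 2) *: (x0 + y) + (1 - 1 / 2) *: - (x0 - y) = y.
  by apply/rowP => i; rewrite !mxE; field.
by apply; lra.
Qed.

(** Fewer than d linear conditions on a space of dimension d have a nonzero solution. This feeds
    both the greedy frame and the orthonormal frames of subspaces. *)
Lemma ortho_extend d n r (B : 'M[R]_(d, n)) (v : nat -> 'rV[R]_n) : row_free B -> (r < d)%N ->
  exists2 c : 'rV[R]_d, c *m B != 0 & forall i, (i < r)%N -> dotp (c *m B) (v i) = 0.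
Proof.
move=> fB rd; pose V : 'M[R]_(r, n) := \matrix_(i < r) v i.
pose k := kermx (B *m V^T).
have k0 : k != 0.
  rewrite -mxrank_eq0 mxrank_ker subn_eq0 -ltnNge.
  by apply: leq_ltn_trans rd; exact: rank_leq_col.
exists (nz_row k).
  have : nz_row k != 0 by rewrite nz_row_eq0.
  by apply: contra => /eqP H; apply/eqP/(row_free_inj fB); rewrite H mul0mx.
move=> i ir; have /sub_kermxP := nz_row_sub k.
move=> /(congr1 (fun M : 'rV_r => M 0 (Ordinal ir))).
by rewrite mulmxA -dotp_row rowK mxE.
Qed.

Lemma greedy_frame n (K : set 'rV[R]_n) : convex_body K -> centrally_symmetric K ->
  exists (U : 'M[R]_n) (a : nat -> R),
  [/\ U *m U^T = 1%:M, forall i, 0 < a i,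
     forall i k, (i <= k < n)%N -> a k <= a i,
     forall i : 'I_n, K (a i *: row i U) &
     K `<=` slab U (fun i => 2 ^+ n * a i)].
Proof.
move=> KB Ks; have KK := convex_body_cconv KB; have [cK vK] := KK.
have [rho rho0 rhoK] := convex_body_ball KB Ks.
pose S r (v : nat -> 'rV[R]_n) := K `&` [set y | forall i, (i < r)%N -> dotp y (v i) = 0].
pose P (r : nat) (v : nat -> 'rV[R]_n) (y : 'rV[R]_n) := y - \sum_(i < r) dotp y (v i) *: v i.
(* If z = 2^-r P_r(y) lies in K, where P_r projects off the first r vectors, then
   t = <z, v_r> satisfies |t| <= a_r, so that the midpoint of z and -t v_r, which
   is 2^-(r+1) P_(r+1)(y), lies in K as well: this is where 2^n comes from. *)
suff H r : (r <= n)%N -> exists (v : nat -> 'rV[R]_n) (a : nat -> R),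
  [/\ forall i k, (i < r)%N -> (k < r)%N -> dotp (v i) (v k) = (i == k)%:R,
     forall i, 0 < a i /\ ((i < r)%N -> K (a i *: v i)),
     forall i k, (i <= k < r)%N -> a k <= a i,
     forall y, S r v y -> forall i, (i < r)%N -> enorm y <= a i &
     forall y, K y -> S r v ((2 ^+ r)^-1 *: P r v y) /\
       forall i, (i < r)%N -> `|dotp y (v i)| <= 2 ^+ n * a i].
  have [v [a [vv aP adec _ Kv]]] := H n (leqnn n).
  exists (\matrix_(i < n) v i), a; split => //.
  - apply/matrixP => i k; rewrite mxE [RHS]mxE -[RHS](vv i k)//; apply: eq_bigr => l _.
    by rewrite !mxE.
  - by move=> i; have [] := aP i.
  - by move=> i; rewrite rowK; have [_] := aP i; apply.
  - by move=> y Ky i; rewrite rowK; have [_] := Kv y Ky; apply.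
elim: r => [_|r IH rn].
  (* The default 1 makes every a_i positive, including those not yet chosen. *)
  exists (fun=> 0), (fun=> 1); split => //.
  by move=> y Ky; rewrite /S /P big_ord0 subr0 expr0 invr1 scale1r; split.
have [v [a [vv aP adec aS Kv]]] := IH (ltnW rn).
have cS : compact (S r v).
  apply: (subclosed_compact _ cK) => [|y []//].
  apply: closedI; first by apply: compact_closed cK; exact: (@norm_hausdorff R 'rV[R]_n).
  have -> : [set y | forall i, (i < r)%N -> dotp y (v i) = 0] =
     \bigcap_(i in [set i | (i < r)%N]) ((fun y => dotp y (v i)) @^-1` [set 0]).
    by apply/seteqP; split => y H i; exact: H.
  apply: closed_bigI => i _; apply: preimage_closed; first by move=> x _; exact: dotp_continuous.
  exact: closed_eq.
have S0 : S r v !=set0.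
  exists 0; split; last by move=> i _; rewrite dotp0l.
  by apply: rhoK; rewrite /cball /= enorm0 ltW.
have [x] := @EVT_max_rV R n (@enorm R n) _ S0 cS (continuous_subspaceT (@enorm_continuous R n)).
rewrite inE => -[Kx xv] xmax.
(* Some nonzero vector is orthogonal to the first r < n ones; shrunk into the inner ball, it
   competes with x. *)
have ax : 0 < enorm x.
  have fB : row_free (1%:M : 'M[R]_n) by rewrite row_free_unit unitmx1.
  have [c] := ortho_extend v fB rn; rewrite mulmx1 => c0 cv.
  apply: (@lt_le_trans _ _ (enorm ((rho / enorm c) *: c))).
    by rewrite enormZ mulr_gt0 ?enorm_gt0// normr_gt0 gt_eqF// divr_gt0// enorm_gt0.
  apply: xmax; rewrite inE; split; last by move=> i ir; rewrite dotpZl cv ?mulr0.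
  apply: rhoK; rewrite /cball /= enormZ ger0_norm ?divr_ge0 ?enorm_ge0 ?(ltW rho0)//.
  by rewrite divfK// gt_eqF// enorm_gt0.
pose w := (enorm x)^-1 *: x.
have wx : enorm x *: w = x by rewrite scalerA mulfV ?scale1r// gt_eqF.
have ww : dotp w w = 1.
  by rewrite dotpZl dotpZr -enorm_sqr; field; rewrite gt_eqF.
have wv i : (i < r)%N -> dotp w (v i) = 0 by move=> ir; rewrite dotpZl xv// mulr0.
pose v' i := if (i == r)%N then w else v i.
pose a' i := if (i == r)%N then enorm x else a i.
have v'E i : (i < r)%N -> v' i = v i by move=> ir; rewrite /v' ltn_eqF.
have a'E i : (i < r)%N -> a' i = a i by move=> ir; rewrite /a' ltn_eqF.
have v'r : v' r = w by rewrite /v' eqxx.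
have a'r : a' r = enorm x by rewrite /a' eqxx.
have lt_case i : (i < r.+1)%N -> i = r \/ (i < r)%N.
  by rewrite ltnS leq_eqVlt => /orP[/eqP|]; [left|right].
have S'S y : S r.+1 v' y -> S r v y.
  by move=> [Ky yv]; split => // i ir; rewrite -v'E// yv// ltnW.
exists v', a'; split.
- move=> i k /lt_case[->|ir] /lt_case[->|kr].
  + by rewrite v'r ww eqxx.
  + by rewrite v'r v'E// wv// gtn_eqF.
  + by rewrite v'r v'E// dotpC wv// ltn_eqF.
  + by rewrite !v'E// vv.
- move=> i; have [a0 Kai] := aP i; split; first by rewrite /a'; case: ifP.
  by move=> /lt_case[->|ir]; [rewrite v'r a'r wx|rewrite v'E// a'E//; exact: Kai].
(* The new vector x lies in S r v, so it is at most as long as each earlier a_i. *)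
- move=> i k /andP[ik /lt_case[kr|kr]].
    rewrite kr a'r; move: ik; rewrite kr leq_eqVlt => /orP[/eqP ->|ir]; first by rewrite a'r.
    by rewrite a'E// aS.
  by rewrite !a'E ?adec ?ik// (leq_ltn_trans ik).
- move=> y /[dup] /S'S Sy [Ky yv] i /lt_case[->|ir]; last by rewrite a'E// aS.
  by rewrite a'r xmax// inE.
- move=> y Ky; have [Sz yv] := Kv y Ky.
  pose z := P r v y.
  have zE : P r.+1 v' y = z - dotp y w *: w.
    rewrite /P big_ord_recr /= v'r opprD addrA; congr (_ - _ - _).
    by apply: eq_bigr => i _; rewrite v'E.
  have zw : dotp z w = dotp y w.
    rewrite /z /P dotpBl dotp_suml big1 ?subr0// => i _.
    by rewrite dotpZl (dotpC (v i)) wv// mulr0.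
  have tw : `|(2 ^+ r)^-1 * dotp y w| <= enorm x.
    rewrite -zw -dotpZl; apply: le_trans (abs_dotp_le _ _) _.
    have -> : enorm w = 1 by rewrite /enorm ww sqrtr1.
    by rewrite mulr1 xmax// inE.
  have yw : `|dotp y w| <= 2 ^+ n * enorm x.
    have p0 : 0 < 2 ^+ r :> R by rewrite exprn_gt0.
    move: tw; rewrite normrM ger0_norm ?invr_ge0 ?(ltW p0)// ler_pdivrMl// => /le_trans; apply.
    by rewrite ler_wpM2r ?(ltW ax)// ler_weXn2l ?ler1n// ltnW.
  split; last by move=> i /lt_case[->|ir]; [rewrite v'r a'r|rewrite v'E// a'E// yv].
  have [Kz zv] := Sz.
  split.
    have -> : (2 ^+ r.+1)^-1 *: P r.+1 v' y =
        (1 / 2) *: ((2 ^+ r)^-1 *: z) + (1 - 1 / 2) *: ((- ((2 ^+ r)^-1 * dotp y w) / enorm x) *: x).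
      rewrite zE scalerBr exprS invfM; congr (_ + _).
        by rewrite scalerA mul1r.
      set t := dotp y w; rewrite /w !scalerA -scaleNr; congr (_ *: _).
      by field; rewrite gt_eqF// expf_neq0.
    have h0 : 0 <= 1 / 2 :> R by lra.
    have h1 : 1 / 2 <= 1 :> R by lra.
    apply: (vK _ _ _ h0 h1) => //.
    by apply: sym_seg => //; rewrite normrM normrN normfV (gtr0_norm ax) ler_pdivrMr// mul1r.
  move=> i ir; rewrite dotpZl zE dotpBl dotpZl.
  case: (lt_case i ir) => [->|ir'].
    by rewrite v'r zw ww mulr1 subrr mulr0.
  rewrite v'E// wv// mulr0 subr0.
  have := zv i ir'; rewrite dotpZl => /eqP; rewrite mulf_eq0 invr_eq0 expf_eq0 pnatr_eq0 andbF /=.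
  by move=> /eqP ->; rewrite mulr0.
Qed.

End Frames.

(** * Sections *)

Section Sections.
Variable R : realType.

Lemma vspace_basis_mx n (F : {vspace 'rV[R]_n}) : exists B : 'M[R]_(\dim F, n),
  row_free B /\ forall x, x \in F <-> exists c, x = c *m B.
Proof.
pose B : 'M[R]_(\dim F, n) := \matrix_i (vbasis F)`_i.
have cB c : c *m B = \sum_i c 0 i *: (vbasis F)`_i.
  by rewrite mulmx_sum_row; apply: eq_bigr => i _; rewrite rowK.
exists B; split.
  rewrite -kermx_eq0; apply/eqP/row_matrixP => i; rewrite row0.
  have : row i (kermx B) *m B = 0 by apply/sub_kermxP; exact: row_sub.
  rewrite cB => H; apply/rowP => k; rewrite [RHS]mxE.
  by have /freeP := basis_free (vbasisP F); apply.
move=> x; split.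
  move=> xF; exists (\row_i coord (vbasis F) i x); rewrite cB {1}(coord_vbasis xF).
  by apply: eq_bigr => i _; rewrite mxE.
move=> [c ->]; rewrite cB; apply: memv_suml => i _; apply: memvZ.
by apply: vbasis_mem; rewrite mem_nth// size_tuple.
Qed.

(** Orthonormal vectors of F can be added one at a time while there are fewer than [\dim F], so the
    choice in [frame] does not fall back on 0. *)
Lemma frame_ortho n (F : {vspace 'rV[R]_n}) : orthonormal_frame (frame F).
Proof.
rewrite /frame; apply: (@xgetPex _ 0 [set U | orthonormal_frame U]).
have [B [fB BF]] := vspace_basis_mx F.
suff H r : (r <= \dim F)%N -> exists v : nat -> 'rV[R]_n,
    (forall i k, (i < r)%N -> (k < r)%N -> dotp (v i) (v k) = (i == k)%:R) /\
    forall i, (i < r)%N -> v i \in F.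
  have [v [vv vF]] := H _ (leqnn _).
  exists (\matrix_(i < \dim F) v i); split; last by move=> i; rewrite rowK vF.
  apply/matrixP => i k; rewrite mxE [RHS]mxE -[RHS](vv i k)//; apply: eq_bigr => l _.
  by rewrite !mxE.
elim: r => [_|r IH rF]; first by exists (fun=> 0).
have [v [vv vF]] := IH (ltnW rF).
have [c c0 cv] := ortho_extend v fB rF.
pose w := (enorm (c *m B))^-1 *: (c *m B).
have ww : dotp w w = 1.
  by rewrite dotpZl dotpZr -enorm_sqr; field; rewrite gt_eqF// enorm_gt0.
have wv i : (i < r)%N -> dotp w (v i) = 0 by move=> ir; rewrite dotpZl cv// mulr0.
have wF : w \in F by apply: memvZ; apply/BF; exists c.
exists (fun i => if (i == r)%N then w else v i).
have lt_case i : (i < r.+1)%N -> i = r \/ (i < r)%N.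
  by rewrite ltnS leq_eqVlt => /orP[/eqP|]; [left|right].
split; last by move=> i /lt_case[->|ir]; [rewrite eqxx|rewrite ltn_eqF// vF].
move=> i k /lt_case[->|ir] /lt_case[->|kr]; rewrite ?eqxx//.
- by rewrite (ltn_eqF kr) wv// gtn_eqF.
- by rewrite (ltn_eqF ir) dotpC wv.
- by rewrite (ltn_eqF ir) (ltn_eqF kr) vv.
Qed.

(** Writing U = M B for a basis B of F, M (B U^T) = 1 with square factors; these commute, whence B
    U^T U = B. *)
Lemma frame_span n (F : {vspace 'rV[R]_n}) (U : 'M[R]_(\dim F, n)) x :
  orthonormal_frame U -> x \in F -> x *m U^T *m U = x.
Proof.
move=> [UU UF] xF; have [B [fB BF]] := vspace_basis_mx F.
have /choice [c cE] : forall i, exists c, row i U = c *m B by move=> i; apply/BF.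
pose M := \matrix_i c i.
have UE : U = M *m B by apply/row_matrixP => i; rewrite row_mul rowK cE.
have MN : M *m (B *m U^T) = 1%:M by rewrite mulmxA -UE.
have [d ->] := (BF x).1 xF.
have H : B *m U^T *m U = B by rewrite [X in _ *m X]UE mulmxA (mulmx1C MN) mul1mx.
by rewrite -!mulmxA (mulmxA B) H.
Qed.

(** Matrices of a fixed size stand for subspaces, so that compactness can be applied to them. *)
Definition section n m (K : set 'rV[R]_n) (U : 'M[R]_(m, n)) : set 'rV[R]_m :=
  [set y | K (y *m U)].

Lemma cconv_section n m (K : set 'rV[R]_n) (U : 'M[R]_(m, n)) : cconv K ->
  U *m U^T = 1%:M -> cconv (section K U).
Proof.
move=> [cK vK] UU; split.
  have [M M0 KM] := compact_enorm_bounded cK.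
  apply: (@bounded_enorm_compact _ _ _ M).
    rewrite (_ : section K U = (fun y => y *m U) @^-1` K)//.
    apply: preimage_closed; first by move=> x _; exact: mulmx_continuous.
    by apply: compact_closed cK; exact: (@norm_hausdorff R 'rV[R]_n).
  by move=> x /KM; rewrite enorm_isometry.
by move=> x y t t0 t1 Kx Ky; rewrite /section /= mulmxDl -!scalemxAl; exact: vK.
Qed.

(** Two orthonormal frames U and V of F differ by the orthogonal matrix V U^T, to which
    quermassintegrals are blind. *)
Lemma quermass_in_frame n d (F : {vspace 'rV[R]_n}) (U : 'M[R]_(d, n)) (K : set 'rV[R]_n) j :
  cconv K -> (j <= d)%N -> d = \dim F -> U *m U^T = 1%:M -> (forall i, row i U \in F) ->
  quermass_in F j (K `&` [set` F]) = quermass j (section K U).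
Proof.
move=> KK jd dE; subst d => UU UF; rewrite /quermass_in.
have [fr_o fr_F] := frame_ortho F.
pose V := frame F.
have VF y : y *m V \in F by rewrite mulmx_sum_row memv_suml// => i _; exact: memvZ.
have -> : in_coords F (K `&` [set` F]) = section K V.
  by apply/seteqP; split => y; rewrite /in_coords /section /=; [case|split=> //; exact: VF].
pose O := V *m U^T.
have VE : O *m U = V.
  by apply/row_matrixP => i; rewrite !row_mul; apply: (frame_span (conj UU UF)); exact: fr_F.
have OO : O *m O^T = 1%:M.
  by rewrite {2}/O trmx_mul trmxK mulmxA VE.
rewrite -(quermass_ortho (cconv_section KK UU) jd OO).
by congr quermass; apply/seteqP; split => y; rewrite /section /= -mulmxA VE.
Qed.

(** If y U' is in K, then y U differs from it by a vector of eta K, so that y U lies in (1 + eta) K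
    by convexity. One section is thus contained in a dilate of the other. *)
Lemma section_perturb n m (K : set 'rV[R]_n) (U U' : 'M[R]_(m, n)) (rho R0 eta : R) j :
  cconv K -> cball rho `<=` K -> K `<=` cball R0 -> 0 < rho -> 0 < eta ->
  U *m U^T = 1%:M -> U' *m U'^T = 1%:M -> (j <= m)%N ->
  (forall y : 'rV[R]_m, enorm y <= R0 -> enorm (y *m (U - U')) <= eta * rho) ->
  quermass j (section K U') <= (1 + eta) ^+ (m - j) * quermass j (section K U).
Proof.
move=> KK rK KR rho0 e0 UU UU' jm UB; have [_ vK] := KK.
have e1 : 0 < 1 + eta by rewrite addr_gt0.
have S1 := cconv_section KK UU; have S2 := cconv_section KK UU'.
rewrite -quermass_scale//; apply: quermass_le => //.
  have -> : [set (1 + eta) *: x | x in section K U] = [set x *m (1 + eta)%:M | x in section K U].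
    by apply/seteqP; split => _ [x Kx <-]; exists x; rewrite ?mul_mx_scalar.
  exact: cconv_mulmx.
move=> y Ky; exists ((1 + eta)^-1 *: y); last by rewrite scalerA mulfV ?scale1r// gt_eqF.
rewrite /section /= -scalemxAl.
have yR : enorm y <= R0 by rewrite -(enorm_isometry y UU'); exact: (KR _ Ky).
have -> : (1 + eta)^-1 *: (y *m U) =
    (1 + eta)^-1 *: (y *m U') + (1 - (1 + eta)^-1) *: (eta^-1 *: (y *m (U - U'))).
  have -> : (1 - (1 + eta)^-1) *: (eta^-1 *: (y *m (U - U'))) = (1 + eta)^-1 *: (y *m (U - U')).
    by rewrite scalerA; congr (_ *: _); field; rewrite !gt_eqF.
  by rewrite -scalerDr -mulmxDr (addrC U') subrK.
apply: vK => //.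
- by rewrite invr_ge0 ltW.
- by rewrite invf_le1// lerDl ltW.
- apply: rK; rewrite /cball /= enormZ ger0_norm ?invr_ge0 ?(ltW e0)//.
  by rewrite ler_pdivrMl// UB.
Qed.

(** By convexity (1 + s)^q lies below its chord 1 + s (2^q - 1) on [0, 1]; this sharper form is the
    one that passes through the induction. *)
Lemma expr1D_le (s : R) q : 0 <= s -> s <= 1 -> (1 + s) ^+ q <= 1 + s * 2 ^+ q.
Proof.
move=> s0 s1.
suff : (1 + s) ^+ q <= 1 + s * (2 ^+ q - 1).
  by move=> /le_trans; apply; rewrite lerD2l ler_wpM2l// gerBl.
elim: q => [|q IH]; first by rewrite !expr0 subrr mulr0 addr0.
rewrite exprS; apply: (@le_trans _ _ ((1 + s) * (1 + s * (2 ^+ q - 1)))).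
  by rewrite ler_wpM2l// addr_ge0.
have p1 : 1 <= 2 ^+ q :> R by rewrite exprn_ege1// ler1n.
rewrite exprS; set p := 2 ^+ q in p1 *.
have : 0 <= s * (1 - s) * (p - 1) by rewrite !mulr_ge0 ?subr_ge0.
nra.
Qed.

(* By [section_perturb] the quermassintegral of a section is a continuous function
   on the compact Stiefel manifold of orthonormal m-frames. *)
Lemma max_section n m (K : set 'rV[R]_n) j : (m <= n)%N -> (j <= m)%N ->
  convex_body K -> centrally_symmetric K ->
  exists2 U : 'M[R]_(m, n), U *m U^T = 1%:M &
    forall V : 'M[R]_(m, n), V *m V^T = 1%:M ->
      quermass j (section K V) <= quermass j (section K U).
Proof.
move=> mn jm KB Ks; have KK := convex_body_cconv KB; have [cK vK] := KK.
have [rho rho0 rhoK] := convex_body_ball KB Ks.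
have [R0 R00 KR] := compact_enorm_bounded cK.
pose G (w : 'rV[R]_(m * n)) := quermass j (section K (vec_mx w)).
pose St := [set w : 'rV[R]_(m * n) | vec_mx w *m (vec_mx w)^T = 1%:M :> 'M[R]_m].
have St0 : St !=set0.
  exists (mxvec (pid_mx m)); rewrite /St /= mxvecK tr_pid_mx mul_pid_mx.
  by rewrite minnn (minn_idPr mn) pid_mx_1.
have cvec i k : continuous (fun w : 'rV[R]_(m * n) => vec_mx w i k : R).
  by under eq_fun do rewrite mxE; exact: coord_continuous.
have cSt : compact St.
  apply: (@bounded_enorm_compact _ _ _ (m * n)%:R).
    have -> : St = \bigcap_(ik in [set: 'I_m * 'I_m])
       ((fun w => \sum_l (vec_mx w : 'M[R]_(m, n)) ik.1 l * (vec_mx w : 'M[R]_(m, n)) ik.2 l) @^-1` [set (ik.1 == ik.2)%:R]).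
      apply/seteqP; split => w.
        move=> wE [i k] _ /=; have := congr1 (fun M : 'M[R]_m => M i k) wE; rewrite mxE [in X in _ = X -> _]mxE => <-.
        by apply: eq_bigr => l _; congr (_ * _); rewrite [RHS]mxE.
      move=> wE; apply/matrixP => i k; rewrite mxE [RHS]mxE.
      by have := wE (i, k) I; rewrite /= => <-; apply: eq_bigr => l _; congr (_ * _); rewrite [LHS]mxE.
    apply: closed_bigI => ik _; apply: preimage_closed; last exact: closed_eq.
    move=> w _; apply: sum_continuous => l x.
    by apply: (@continuousM _ _ (fun w : 'rV[R]_(m * n) => vec_mx w ik.1 l) (fun w : 'rV[R]_(m * n) => vec_mx w ik.2 l)); exact: cvec.
  move=> w wE; apply: le_trans (enorm_le_sum w) _.
  apply: (@le_trans _ _ (\sum_(i < m * n) 1)); last by rewrite sumr_const card_ord.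
  apply: ler_sum => i _; case/mxvec_indexP: i => i k.
  have -> : w 0 (mxvec_index i k) = row i (vec_mx w) 0 k by rewrite !mxE.
  apply: le_trans (coord_le_enorm _ _) _.
  by rewrite /enorm dotp_rows// eqxx sqrtr1.
pose M0 := quermass j (@cball R m R0).
have GM w : St w -> 0 <= G w <= M0.
  move=> wS; have S1 := cconv_section KK wS; rewrite quermass_ge0//=.
  apply: quermass_le => //; first exact: (cconv_cball _ (ltW R00)).
  by move=> y /KR; rewrite /cball /= enorm_isometry.
(* If the entries of two frames differ by at most t, then |y (U - U')| <= R0 m n t <= c t rho for
   |y| <= R0. The successor keeps c positive when m n = 0. *)
pose c := R0 * (m * n).+1%:R / rho.
have c0 : 0 < c by rewrite divr_gt0// mulr_gt0.
have pert w w' t : St w -> St w' -> 0 < t -> `|w - w'| <= t ->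
    G w' <= (1 + c * t) ^+ (m - j) * G w.
  move=> wS wS' t0 wt; apply: (@section_perturb _ _ _ _ _ rho R0) => //; first by rewrite mulr_gt0.
  move=> y yR; rewrite -linearB /=.
  have -> : y *m vec_mx (w - w') = \sum_i y 0 i *: row i (vec_mx (w - w')) by rewrite mulmx_sum_row.
  apply: le_trans (enorm_sum _ _) _.
  apply: (@le_trans _ _ (\sum_(i < m) R0 * (n%:R * t))).
    apply: ler_sum => i _; rewrite enormZ; apply: ler_pM; rewrite ?enorm_ge0//.
      exact: le_trans (coord_le_enorm _ _) yR.
    apply: le_trans (enorm_le_sum _) _.
    apply: (@le_trans _ _ (\sum_(k < n) t)); last by rewrite sumr_const card_ord mulr_natl.
    apply: ler_sum => k _; rewrite [row i _ 0 k]mxE [vec_mx _ i k]mxE.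
    exact: le_trans (coord_le_norm _ _) wt.
  rewrite sumr_const card_ord -[_ *+ m]mulr_natl.
  have -> : c * t * rho = R0 * t * (m * n).+1%:R by rewrite /c; field; rewrite gt_eqF.
  have -> : m%:R * (R0 * (n%:R * t)) = R0 * t * (m * n)%:R by rewrite natrM; ring.
  by apply: ler_wpM2l; [rewrite mulr_ge0// ltW|rewrite ler_nat].
have [w0 [w0S wmax]] : exists w, w \in St /\ forall t, t \in St -> G t <= G w.
  suff cG : {within St, continuous G}.
    by have [w wS wmax] := @EVT_max_rV R _ G St St0 cSt cG; exists w.
  apply/subspace_continuousP => w wS; apply/cvgrPdist_le => /= e e0.
  have M00 : 0 <= M0 by have /andP[] := GM w wS; exact: le_trans.
  (* The increment of G over a distance t is at most c t 2^(m-j) M0 as long as c t <= 1; so t is the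
     smaller of 1/c and e/q. *)
  pose q := c * 2 ^+ (m - j) * (M0 + 1).
  have q0 : 0 < q by apply: mulr_gt0; [apply: mulr_gt0 => //; exact: exprn_gt0|exact: ltr_wpDl].
  pose t := Num.min c^-1 (e / q).
  have t0 : 0 < t by rewrite lt_min invr_gt0 c0 divr_gt0.
  have ct0 : 0 <= c * t by rewrite ltW// mulr_gt0.
  have ct1 : c * t <= 1.
    by rewrite -[leRHS](mulfV (lt0r_neq0 c0)) ler_pM2l// ge_min lexx.
  have tq : t * q <= e by rewrite -ler_pdivlMr// ge_min lexx orbT.
  have ex := expr1D_le (m - j) ct0 ct1.
  have key a b : 0 <= a -> a <= M0 -> b <= (1 + c * t) ^+ (m - j) * a -> b - a <= e.
    move=> a0 aM ba; apply: le_trans tq.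
    apply: (@le_trans _ _ (c * t * 2 ^+ (m - j) * a)).
      rewrite lerBlDr; apply: le_trans ba _.
      by apply: le_trans (ler_wpM2r a0 ex) _; rewrite mulrDl mul1r addrC.
    rewrite /q; have -> : t * (c * 2 ^+ (m - j) * (M0 + 1)) = c * t * 2 ^+ (m - j) * (M0 + 1) by ring.
    by apply: ler_wpM2l; [rewrite mulr_ge0|apply: le_trans aM _; rewrite lerDl].
  apply/nbhs_ballP; exists t => //= w' ww' wS'.
  have wt : `|w - w'| <= t by move: ww'; rewrite -ball_normE /= => /ltW.
  have /andP[g0 gM] := GM w wS; have /andP[g0' gM'] := GM w' wS'.
  rewrite ler_distl; apply/andP; split.
    by rewrite lerBlDr -lerBlDl; apply: key => //; exact: pert.
  by rewrite -lerBlDl; apply: key => //; apply: pert => //; rewrite distrC.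
exists (vec_mx w0); first by move: w0S; rewrite inE.
move=> V VV; have := wmax (mxvec V); rewrite /G mxvecK; apply.
by rewrite inE /St /= mxvecK.
Qed.

End Sections.

Theorem theorem1p4 (R : realType) (n k j : nat) (hjk : (j + k < n)%N) :
  exists2 alpha : R, 0 < alpha &
    forall K : set 'rV[R]_n, convex_body K -> centrally_symmetric K ->
    exists2 M : R,
      is_max [set quermass_in F j (K `&` [set` F]) ^+ (n - j)%N
             | F in grassmann R n (n - k)%N] M &
      quermass j K ^+ (n - k - j)%N <= alpha * M.
Proof.
set m := (n - k)%N; have mn : (m <= n)%N by exact: leq_subr.
have jm : (j < m)%N by rewrite ltn_subRL addnC.
have jn : (j < n)%N by exact: leq_trans mn.
have m0 : (0 < m)%N by exact: leq_ltn_trans jm.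
(* C and c are the constants of [quermass_upper] and [quermass_lower]. The bounds W_j(K) <= C A and
   c b <= g are raised to the powers m - j and n - j, whence alpha. *)
pose C : R := (2 * (2 ^+ n + 1)) ^+ n.
pose c : R := (2 / m%:R) ^+ m / 'C(m, j)%:R.
have C0 : 0 < C by rewrite exprn_gt0// mulr_gt0// addr_gt0// exprn_gt0.
have c0 : 0 < c by rewrite divr_gt0 ?ltr0n ?bin_gt0 1?ltnW// exprn_gt0// divr_gt0// ltr0n.
exists (C ^+ (m - j) / c ^+ (n - j)); first by rewrite divr_gt0// exprn_gt0.
move=> K KB Ks; have KK := convex_body_cconv KB.
have [U UU Umax] := max_section mn (ltnW jm) KB Ks.
pose g := quermass j (section K U).
have g0 : 0 <= g by apply: quermass_ge0 (ltnW jm); exact: cconv_section.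
exists (g ^+ (n - j)).
  split.
    (* The maximum is attained at the row span of the maximizing frame U, obtained as the image of y
       |-> y U. *)
    pose f : 'Hom('rV[R]_m, 'rV[R]_n) := linfun (mulmxr U).
    have fE y : f y = y *m U by rewrite lfunE.
    have dF : \dim (limg f) = m.
      have := limg_ker_dim f fullv; rewrite dimvf.
      have -> : (fullv :&: lker f)%VS = 0%VS.
        apply/eqP; rewrite -subv0; apply/subvP => y; rewrite memv_cap memv_ker => /andP[_ /eqP yU].
        rewrite memv0; apply/eqP/enorm_eq0.
        by rewrite -(enorm_isometry y UU) -fE yU enorm0.
      by rewrite dimv0 add0n => ->; rewrite /dim /= mul1n.
    exists (limg f) => //; congr (_ ^+ _).
    apply: quermass_in_frame => //; [exact: ltnW|].
    by move=> i; rewrite rowE -fE memv_img// memvf.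
  move=> _ [F dF <-].
  have Hmax d (V : 'M[R]_(d, n)) : d = m -> V *m V^T = 1%:M ->
      quermass j (section K V) <= g.
    by move=> dm; subst d; exact: Umax.
  have [VV VF] := frame_ortho F.
  have jF : (j <= \dim F)%N by rewrite dF ltnW.
  rewrite (quermass_in_frame KK jF erefl VV VF) lerXn2r ?nnegrE//; last exact: Hmax.
  by apply: quermass_ge0 jF; exact: cconv_section.
have [V [a [VV a0 adec Ka Ksub]]] := greedy_frame KB Ks.
pose A := \prod_(0 <= i < n - j) a i.
pose b := \prod_(0 <= i < m - j) a i.
have b0 : 0 < b by apply: prodr_gt0.
have up := quermass_upper jn KK VV a0 adec Ksub.
pose V1 : 'M[R]_(m, n) := \matrix_(i < m) row (widen_ord mn i) V.
have V1V1 : V1 *m V1^T = 1%:M.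
  apply/matrixP => i l; rewrite [RHS]mxE.
  have -> : (i == l) = (widen_ord mn i == widen_ord mn l) by [].
  by rewrite -(dotp_rows _ _ VV) mxE; apply: eq_bigr => t _; rewrite !mxE.
have low : c * b <= g.
  apply: le_trans (Umax V1 V1V1).
  (* In the coordinates given by V1, the vectors a_i u_i lie along the standard basis. *)
  apply: (@quermass_lower _ m j _ 1%:M a jm) => //.
  - exact: cconv_section.
  - by move=> y Ky; rewrite /section /= mulNmx; exact: Ks.
  - by rewrite trmx1 mulmx1.
  - move=> i; rewrite /section /= -scalemxAl row1 -rowE rowK; exact: (Ka (widen_ord mn i)).
(* With l the last and smallest factor of b, A <= b l^(n-m) and l^(m-j) <= b; hence A^(m-j) <=
   b^(m-j) (l^(m-j))^(n-m) <= b^(n-j). *)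
have AB : A ^+ (m - j) <= b ^+ (n - j).
  have jm' : (m - j <= n - j)%N by exact: leq_sub2r.
  pose l := a (m - j).-1; have l0 : 0 < l by exact: a0.
  have mj0 : (0 < m - j)%N by rewrite subn_gt0.
  have H1 : A <= b * l ^+ (n - m).
    rewrite /A (big_cat_nat (n := m - j))//= ler_pM2l//.
    have -> : l ^+ (n - m) = \prod_(m - j <= i < n - j) l.
      by rewrite prodr_const_nat subnBA ?(ltnW jm)// subnK// ltnW.
    rewrite !big_nat; apply: ler_prod => i /andP[ji ik]; rewrite ltW//=.
    by apply: adec; rewrite (leq_trans (leq_pred _))//= (leq_trans ik)// leq_subr.
  have H2 : l ^+ (m - j) <= b.
    have -> : l ^+ (m - j) = \prod_(0 <= i < m - j) l by rewrite prodr_const_nat subn0.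
    rewrite /b !big_nat; apply: ler_prod => i /andP[_ ij]; rewrite ltW//=.
    apply: adec; apply/andP; split; first by rewrite -ltnS prednK.
    by rewrite prednK// (leq_trans (leq_subr _ _)).
  apply: (@le_trans _ _ ((b * l ^+ (n - m)) ^+ (m - j))).
    by rewrite lerXn2r// nnegrE ?prodr_ge0 ?mulr_ge0 ?exprn_ge0 ?ltW// => i; rewrite ltW.
  rewrite exprMn -exprM mulnC exprM.
  have -> : (n - j = (m - j) + (n - m))%N by rewrite addnC addnBA ?subnK// ltnW.
  rewrite exprD ler_pM2l ?exprn_gt0//.
  by rewrite lerXn2r ?nnegrE ?exprn_ge0// ltW.
have q0 : 0 <= quermass j K by apply: quermass_ge0 => //; exact: ltnW.
apply: (@le_trans _ _ ((C * A) ^+ (m - j))).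
  by rewrite lerXn2r ?nnegrE// mulr_ge0 ?(ltW C0)// prodr_ge0// => i _; exact: ltW.
rewrite exprMn -mulrA ler_pM2l ?exprn_gt0//; apply: le_trans AB _.
rewrite ler_pdivlMl ?exprn_gt0// -exprMn.
by rewrite lerXn2r ?nnegrE// mulr_ge0 ?ltW.
Qed.
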